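(* Fix constants $\alpha,\beta>0$ and $s\in[0,1]$. Let $(G_1,G_2)\sim \mathrm{CSBM}\left(n,\frac{\alpha\log n}{n},\frac{\beta\log n}{n},s\right)$ with community labels $\boldsymbol{\sigma_*}$. Suppose that $$\left(1-(1-s)^2\right)\mathrm{D}_+(\alpha,\beta)<1$$ or that $$s^2\,\mathrm{T}_c(\alpha,\beta)+s(1-s)\,\mathrm{D}_+(\alpha,\beta)<1 .$$ Then for any estimator $\widetilde{\boldsymbol{\sigma}}=\widetilde{\boldsymbol{\sigma}}(G_1,G_2)\in\{-1,+1\}^n$ we have $$\lim_{n\to\infty}\mathbb{P}\left(\mathsf{ov}(\widetilde{\boldsymbol{\sigma}},\boldsymbol{\sigma_*})=1\right)=0 .$$
   Context: $\mathrm{SBM}(n,p,q)$: a random graph on vertex set $[n]=\{1,\dots,n\}$. Each vertex $i$ has a community label $\sigma_*(i)\in\{+1,-1\}$, i.i.d. uniform; $\boldsymbol{\sigma_*}=\{\sigma_*(i)\}_{i=1}^n$. Given the labels, edges are present independently over pairs of distinct vertices, $\{i,j\}$ with probability $p$ if $\sigma_*(i)=\sigma_*(j)$ and with probability $q$ otherwise. $\mathrm{CSBM}(n,p,q,s)$: generate a parent graph $G\sim\mathrm{SBM}(n,p,q)$ with labels $\boldsymbol{\sigma_*}$. Given $G$, let $G_1$ and $G_2'$ be two independent random subgraphs on $[n]$, each obtained by keeping every edge of $G$ independently with probability $s$ (non-edges stay non-edges). Let $\pi_*$ be a uniformly random permutation of $[n]$ independent of everything else, and let $G_2$ be obtained from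 $G_2'$ by relabeling each vertex $i$ as $\pi_*(i)$. The output is $(G_1,G_2)$. Here $n$ is taken large enough that the edge probabilities are at most $1$; $\log$ is the natural logarithm. $\mathrm{D}_+(\alpha,\beta):=\left(\frac{\sqrt\alpha-\sqrt\beta}{\sqrt2}\right)^2=\frac{\alpha+\beta}{2}-\sqrt{\alpha\beta}$ and $\mathrm{T}_c(\alpha,\beta):=\frac{\alpha+\beta}{2}$. The overlap is $\mathsf{ov}(\widetilde{\boldsymbol{\sigma}},\boldsymbol{\sigma_*}):=\frac1n\left|\sum_{i=1}^n\widetilde\sigma(i)\sigma_*(i)\right|$. An estimator is a function of the observed pair $(G_1,G_2)$ (it may use the known parameters, but not $\boldsymbol{\sigma_*}$ or $\pi_*$). *)

(* Defs.v *)
From HB Require Import structures.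
From mathcomp Require Import all_boot all_order all_algebra all_fingroup.
From mathcomp Require Import all_classical all_reals all_analysis.

Set Implicit Arguments.
Unset Strict Implicit.
Unset Printing Implicit Defensive.

Import Order.TTheory GRing.Theory Num.Theory.
Import numFieldNormedType.Exports.

Local Open Scope ring_scope.

(* Unordered pairs of distinct vertices. The vertex set [n] is 'I_n. *)
Definition edge (n : nat) : finType := {e : {set 'I_n} | #|e| == 2%N}.

(* A simple graph on the labelled vertex set 'I_n is its set of edges. *)
Definition graph (n : nat) : finType := {set edge n}.

(* Labels are encoded by booleans: b stands for the sign (-1) ^+ b. *)
Definition labels (n : nat) : finType := {ffun 'I_n -> bool}.

Definition label_sign (R : pzRingType) (b : bool) : R := (-1) ^+ b.

Lemma relabel_edge_subproof (n : nat) (pi : {perm 'I_n}) (e : edge n) :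
  #|pi @: val e| == 2%N.
Proof. by rewrite (card_imset _ (@perm_inj _ pi)); exact: valP e. Qed.

Definition relabel_edge (n : nat) (pi : {perm 'I_n}) (e : edge n) : edge n :=
  exist _ (pi @: val e) (relabel_edge_subproof pi e).

Definition relabel (n : nat) (pi : {perm 'I_n}) (G : graph n) : graph n :=
  relabel_edge pi @: G.

Definition same_label (n : nat) (sigma : labels n) (e : edge n) : bool :=
  [forall i in val e, forall j in val e, sigma i == sigma j].

Section Model.
Context {R : realType}.

Definition labels_pmf (n : nat) (sigma : labels n) : R :=
  \prod_(i < n) bernoulli_pmf 2^-1 (sigma i).

(* Conditional law of the parent graph given the labels. *)
Definition sbm_pmf (n : nat) (p q : R) (sigma : labels n) (G : graph n) : R :=
  \prod_(e : edge n)
    bernoulli_pmf (if same_label sigma e then p else q) (e \in G).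

(* Conditional law, given G, of a subgraph H keeping each edge of G
   independently with probability s; a non-edge of G is kept with
   probability 0. *)
Definition subsample_pmf (n : nat) (s : R) (G H : graph n) : R :=
  \prod_(e : edge n) bernoulli_pmf (if e \in G then s else 0) (e \in H).

(* Joint law of (sigma, G, G1, G2', pi). For p = a log n / n and
   q = b log n / n it is a probability mass function once n is large enough
   that p, q <= 1. *)
Definition csbm_pmf (n : nat) (p q s : R) (sigma : labels n)
    (G G1 G2' : graph n) (pi : {perm 'I_n}) : R :=
  labels_pmf sigma * sbm_pmf p q sigma G *
  (subsample_pmf s G G1 * subsample_pmf s G G2') * (n`!%:R)^-1.

(* Probability under CSBM(n, p, q, s) of an event E about the labels and the
   output pair (G1, G2), where G2 is G2' relabelled by pi. *)
Definition csbm_prob (n : nat) (p q s : R)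
    (E : labels n -> graph n -> graph n -> bool) : R :=
  \sum_(sigma : labels n) \sum_(G : graph n) \sum_(G1 : graph n)
  \sum_(G2' : graph n) \sum_(pi : {perm 'I_n} | E sigma G1 (relabel pi G2'))
    csbm_pmf p q s sigma G G1 G2' pi.

Definition Dplus (a b : R) : R :=
  ((Num.sqrt a - Num.sqrt b) / Num.sqrt 2) ^+ 2.

Definition Tc (a b : R) : R := (a + b) / 2.

Definition overlap (n : nat) (sigma tau : labels n) : R :=
  n%:R^-1 * `| \sum_(i < n) label_sign R (sigma i) * label_sign R (tau i) |.

End Model.

(* Main.v *)
Require Import Defs.
From HB Require Import structures.
From mathcomp Require Import all_boot all_order all_algebra all_fingroup.
From mathcomp Require Import all_classical all_reals all_analysis.
From mathcomp Require Import ring lra.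

Import Order.TTheory GRing.Theory Num.Theory.
Import numFieldNormedType.Exports.

Set Implicit Arguments.
Unset Strict Implicit.
Unset Printing Implicit Defensive.

Local Open Scope ring_scope.

(** Why exact recovery is impossible.  Call a configuration the hidden labels
    sigma, the two subgraphs and the hidden alignment pi; its weight is its
    probability.  Suppose that from a configuration one can pass to many others
    which show the same pair of graphs to the observer, have at least the same
    weight, and carry labels obtained from sigma by exchanging the labels of one
    vertex u of the first community with one vertex v of the second.  If
    the estimator is right at the original configuration, the observation
    determines sigma up to a global sign, and the labels after the exchange
    then determine the pair (u, v); so each configuration arises in at most two
    ways.  Counting weights, being right on the configurations that
    offer at least K exchanges has probability at most 2 / K
    ([exchange_bound], [recovery_le]).  So it suffices that the number of
    exchanges tends to infinity in probability.

    There are two kinds of exchange, one for each of the two conditions.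
    - Keep both graphs and the alignment, and exchange only the labels.  The
      likelihood ratio of the two types of vertex pair, inside and across
      communities, depends on the state of the pair only through whether it is
      joined in the union graph.  The weight is therefore preserved when u and v both have as many neighbours
      in the union graph in their own community as in the other one
      ([union_exchange]).
    - Exchange u and v in the labels, in the second graph and in the alignment;
      the observer sees the same pair of graphs ([realigned_move]).  If u and v
      are isolated in the intersection graph and both are balanced with respect
      to the edges of the first graph only, the weight does not decrease: the
      second graph is transported with its labels, the first one does not
      notice the exchange by balance, and a newly created common edge can only
      help, since the two graphs are positively correlated
      ([intersection_exchange]).

    Both kinds ask a vertex to meet a set of states (the hits) equally often
    towards the two communities and to avoid another set of states (the
    clashes); they are treated together as an [exchange_scheme].  If hits and
    clashes occur along an edge at rates kS and kT, relative to the edge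
    probability, a vertex has exactly kS sqrt(alpha beta) / 2 ln n hits towards
    each community and no clash with probability
    n ^ (- E + o(1)), where
    E = (kS + kT) (alpha + beta) / 2 - kS sqrt(alpha beta)
    ([binomial_pair_ge], [good_prob_ge]).  For the two kinds of exchange E is
    the left-hand side of the first and of the second condition.  When E < 1, a
    set V0 of n / (ln n) ^ 2 vertices contains many suitable vertices on
    average.  Such a vertex is rarely joined to the rest of V0, and the edges
    from V0 to the outside are independent for distinct vertices, so that the
    second moment method shows that both communities have many suitable
    vertices in V0 with high probability ([few_good]).  Every estimate is made
    effective: the probability of recovery is at most C / ln n for n large
    ([scheme_prob_le]). *)

(** * Second moments and product measures on finite sets *)

Section FiniteProbability.
Context {R : realType}.

Definition mass (T : finType) (w : T -> R) (P : pred T) : R :=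
  \sum_(x | P x) w x.

Lemma massE (T : finType) (w : T -> R) (P : pred T) :
  mass w P = \sum_x w x * (P x)%:R.
Proof.
by rewrite /mass big_mkcond; apply: eq_bigr => x _; case: (P x);
  rewrite ?mulr1 ?mulr0.
Qed.

Lemma mass_ge0 (T : finType) (w : T -> R) (P : pred T) :
  (forall x, 0 <= w x) -> 0 <= mass w P.
Proof. by move=> w0; apply: sumr_ge0. Qed.

Lemma le_mass (T : finType) (w : T -> R) (P Q : pred T) :
  (forall x, 0 <= w x) -> (forall x, P x -> Q x) -> mass w P <= mass w Q.
Proof.
move=> w0 PQ; rewrite !massE; apply: ler_sum => x _; apply: ler_wpM2l => //.
by rewrite ler_nat; case: (P x) (PQ x) => // ->.
Qed.

Lemma mass_or (T : finType) (w : T -> R) (P Q : pred T) :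
  (forall x, 0 <= w x) ->
  mass w (fun x => P x || Q x) <= mass w P + mass w Q.
Proof.
move=> w0; rewrite !massE -big_split /=; apply: ler_sum => x _.
rewrite -mulrDr; apply: ler_wpM2l => //.
by rewrite -natrD ler_nat; case: (P x); case: (Q x).
Qed.

(** Chebyshev for a sum of indicators that are almost pairwise independent: the
    centre t = #|C| a is not exactly the mean, but the second moment around t is
    at most t + 2 eta t ^ 2, the error eta entering through the cross term. *)
Lemma second_moment (T J : finType) (w : T -> R) (C : {set J})
    (A : J -> pred T) (a eta lam : R) :
  (forall x, 0 <= w x) -> \sum_x w x = 1 ->
  0 < a -> 0 < lam -> (0 < #|C|)%N ->
  (forall u, u \in C -> a * (1 - eta) <= mass w (A u) <= a) ->
  (forall u v, u \in C -> v \in C -> u != v ->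
     mass w (fun x => A u x && A v x) <= a ^+ 2) ->
  mass w (fun x => lam * (#|C|%:R * a)
                   <= `| #|[set u in C | A u x]|%:R - #|C|%:R * a |)
  <= ((#|C|%:R * a)^-1 + 2 * eta) / lam ^+ 2.
Proof.
move=> w0 w1 a0 lam0 C0 A1 A2.
set t : R := #|C|%:R * a.
have t0 : 0 < t by rewrite mulr_gt0 // ltr0n.
pose X x : R := \sum_(u in C) (A u x)%:R.
have XE x : #|[set u in C | A u x]|%:R = X x.
  rewrite -sum1_card natr_sum /X [in RHS](big_mkcond) [in LHS]big_mkcond /=.
  by apply: eq_bigr => u _; rewrite inE; case: (u \in C); case: (A u x).
have EX : t * (1 - eta) <= \sum_x w x * X x.
  rewrite /X; under [leRHS]eq_bigr do rewrite mulr_sumr.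
  rewrite exchange_big /= /t -mulrA mulr_natl -sumr_const.
  by apply: ler_sum => u uC; rewrite -massE; case/andP: (A1 u uC).
have EX2 : \sum_x w x * X x ^+ 2 <= t + t ^+ 2.
  have -> : \sum_x w x * X x ^+ 2
     = \sum_(u in C) \sum_(v in C) mass w (fun x => A u x && A v x).
    under eq_bigr => x _ do (rewrite expr2 /X mulr_suml mulr_sumr;
      under eq_bigr do rewrite !mulr_sumr).
    rewrite exchange_big /=; apply: eq_bigr => u _.
    rewrite exchange_big /=; apply: eq_bigr => v _.
    by rewrite massE; apply: eq_bigr => x _; rewrite -natrM mulnb.
  have -> : t + t ^+ 2 = \sum_(u in C) (a + \sum_(v in C) a ^+ 2).
    rewrite big_split /= !sumr_const -[in RHS]mulr_natl.
    by rewrite -[a ^+ 2 *+ _ *+ _]mulr_natl -[a ^+ 2 *+ _]mulr_natl /t; ring.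
  apply: ler_sum => u uC; rewrite (bigD1 u uC) /=; apply: lerD.
    have /andP[_] := A1 u uC; apply: le_trans.
    by apply: le_mass => // x /andP[].
  rewrite [leRHS](bigD1 u uC) /= -[leLHS]add0r; apply: lerD.
    by rewrite sqr_ge0.
  by apply: ler_sum => v /andP[vC vu]; apply: A2; rewrite // eq_sym.
have V : \sum_x w x * (X x - t) ^+ 2 <= t + 2 * eta * t ^+ 2.
  have -> : \sum_x w x * (X x - t) ^+ 2
     = \sum_x w x * X x ^+ 2 - 2 * t * (\sum_x w x * X x) + t ^+ 2.
    have -> : t ^+ 2 = \sum_x w x * t ^+ 2 by rewrite -mulr_suml w1 mul1r.
    rewrite mulr_sumr -sumrB -big_split /=.
    by apply: eq_bigr => x _; ring.
  have : 2 * t * (t * (1 - eta)) <= 2 * t * (\sum_x w x * X x).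
    by apply: ler_wpM2l => //; rewrite mulr_ge0 // ltW.
  nra.
have M : (lam * t) ^+ 2 * mass w (fun x => lam * t <= `|X x - t|)
         <= \sum_x w x * (X x - t) ^+ 2.
  rewrite /mass mulr_sumr [leRHS](bigID (fun x => lam * t <= `|X x - t|)) /=.
  rewrite -[leLHS]addr0; apply: lerD; last first.
    by apply: sumr_ge0 => x _; rewrite mulr_ge0 // sqr_ge0.
  apply: ler_sum => x xt; rewrite mulrC; apply: ler_wpM2l => //.
  rewrite -[leRHS]real_normK ?num_real //; apply: lerXn2r => //; rewrite nnegrE.
  by rewrite mulr_ge0 // ltW.
under [X in mass w X]eq_fun do rewrite XE.
have lt0 : 0 < (lam * t) ^+ 2 by rewrite exprn_gt0 // mulr_gt0.
rewrite -(ler_pM2l lt0); apply: (le_trans M); apply: (le_trans V).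
rewrite le_eqVlt; apply/orP; left; apply/eqP.
by field; rewrite !gt_eqF.
Qed.

End FiniteProbability.

Section ProductMeasure.
Context {R : realType} (E Z : finType) (mu : E -> Z -> R).
Hypothesis mu_ge0 : forall e z, 0 <= mu e z.
Hypothesis mu_sum1 : forall e, \sum_z mu e z = 1.

Definition prod_pmf (x : {ffun E -> Z}) : R := \prod_e mu e (x e).

Lemma prod_pmf_ge0 x : 0 <= prod_pmf x.
Proof. by apply: prodr_ge0. Qed.

Lemma prod_pmf_factor (f : E -> Z -> R) :
  \sum_x prod_pmf x * \prod_e f e (x e) = \prod_e \sum_z mu e z * f e z.
Proof.
by rewrite bigA_distr_bigA /=; apply: eq_bigr => x _; rewrite -big_split.
Qed.

Lemma prod_pmf_sum1 : \sum_x prod_pmf x = 1.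
Proof.
transitivity (\prod_e \sum_z mu e z); first by rewrite bigA_distr_bigA.
by apply: big1 => e _; exact: mu_sum1.
Qed.

Definition depends_on (D : {set E}) (f : {ffun E -> Z} -> R) :=
  forall x y : {ffun E -> Z}, {in D, x =1 y} -> f x = f y.

(** Take two independent copies x and y, and exchange their coordinates in A.
    This preserves the weight of the pair, and turns f x * g y into
    f x * g x evaluated on a single copy. *)
Lemma prod_pmf_indep (A B : {set E}) (f g : {ffun E -> Z} -> R) :
  depends_on A f -> depends_on B g -> (forall e, e \in A -> e \notin B) ->
  \sum_x prod_pmf x * (f x * g x)
  = (\sum_x prod_pmf x * f x) * (\sum_x prod_pmf x * g x).
Proof.
move=> fA gB AB.
rewrite -[LHS]mulr1 -[X in _ * X = _]prod_pmf_sum1 !big_distrlr /= !pair_big /=.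
pose mix (x y : {ffun E -> Z}) := [ffun e => if e \in A then x e else y e].
pose h (p : {ffun E -> Z} * {ffun E -> Z}) := (mix p.1 p.2, mix p.2 p.1).
have hK : involutive h.
  by case=> x y; rewrite /h /=; congr (_, _); apply/ffunP => e;
    rewrite !ffunE; case: (e \in A).
rewrite (reindex_inj (inv_inj hK)) /=; apply: eq_bigr => -[x y] _ /=.
have -> : f (mix x y) = f x.
  by apply: fA => e eA; rewrite ffunE eA.
have -> : g (mix x y) = g y.
  by apply: gB => e eB; rewrite ffunE ifN //; apply: contraL eB; exact: AB.
have -> : prod_pmf (mix x y) * (f x * g y) * prod_pmf (mix y x)
   = prod_pmf (mix x y) * prod_pmf (mix y x) * (f x * g y) by ring.
have -> : prod_pmf (mix x y) * prod_pmf (mix y x) = prod_pmf x * prod_pmf y.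
  rewrite /prod_pmf -!big_split /=; apply: eq_bigr => e _.
  by rewrite !ffunE; case: (e \in A) => //; rewrite mulrC.
by ring.
Qed.

Lemma mass_indep (A B : {set E}) (P Q : pred {ffun E -> Z}) :
  depends_on A (fun x => (P x)%:R) -> depends_on B (fun x => (Q x)%:R) ->
  (forall e, e \in A -> e \notin B) ->
  mass prod_pmf (fun x => P x && Q x) = mass prod_pmf P * mass prod_pmf Q.
Proof.
move=> PA QB AB; rewrite !massE -(prod_pmf_indep PA QB AB).
by apply: eq_bigr => x _; rewrite -mulnb natrM.
Qed.

Lemma mass_all (P : E -> pred Z) :
  mass prod_pmf (fun x => [forall e, P e (x e)])
  = \prod_e \sum_(z | P e z) mu e z.
Proof.
rewrite massE; transitivity (\prod_e \sum_z mu e z * (P e z)%:R); last first.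
  apply: eq_bigr => e _; rewrite [RHS]big_mkcond /=.
  by apply: eq_bigr => z _; case: (P e z); rewrite ?mulr1 ?mulr0.
rewrite -prod_pmf_factor; apply: eq_bigr => x _; congr (_ * _).
case: (boolP [forall e, P e (x e)]) => [/forallP h|].
  by rewrite big1 // => e _; rewrite h.
rewrite negb_forall => /existsP[e h]; symmetry.
by apply/eqP/prodf_eq0; exists e => //; rewrite (negbTE h).
Qed.

(** Sort the outcomes according to the set of coordinates of D that meet S;
    each of the 'C(#|D|, k) sets contributes a product of one-coordinate
    probabilities. *)
Lemma mass_binomial (D : {set E}) (S T : pred Z) (a b : R) (k : nat) :
  (forall e, e \in D -> \sum_(z | S z) mu e z = a) ->
  (forall e, e \in D -> \sum_(z | T z) mu e z = b) ->
  (forall z, S z -> ~~ T z) ->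
  mass prod_pmf (fun x => (#|[set e in D | S (x e)]| == k)
                          && [forall e in D, ~~ T (x e)])
  = a ^+ k * (1 - a - b) ^+ (#|D| - k) *+ 'C(#|D|, k).
Proof.
move=> Sa Tb ST.
pose sel (x : {ffun E -> Z}) := [set e in D | S (x e)].
rewrite /mass (partition_big sel
  (fun K : {set E} => (K \subset D) && (#|K| == k))) /=; last first.
  move=> x /andP[/eqP xk _]; apply/andP; split; last exact/eqP.
  by apply/fintype.subsetP => e; rewrite inE => /andP[].
have -> : a ^+ k * (1 - a - b) ^+ (#|D| - k) *+ 'C(#|D|, k)
   = \sum_(K : {set E} | (K \subset D) && (#|K| == k))
       a ^+ k * (1 - a - b) ^+ (#|D| - k).
  rewrite sumr_const; congr (_ *+ _); rewrite -cards_draws.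
  by apply: eq_card => K; rewrite inE.
apply: eq_bigr => K /andP[KD /eqP Kk].
pose Q e z := if e \in K then S z else (e \in D) ==> ~~ S z && ~~ T z.
rewrite (eq_bigl (fun x : {ffun E -> Z} => [forall e, Q e (x e)])); last first.
  move=> x; apply/idP/forallP.
    move=> /andP[/andP[_ /forallP noT] /eqP selK] e; rewrite /Q.
    rewrite -selK inE; case: (boolP (e \in D)) => eD //=.
    by case: ifP => //= ->; have := noT e; rewrite eD.
  move=> h; have selK : sel x = K.
    apply/finset.setP => e; rewrite inE; have := h e; rewrite /Q.
    case: ifP => [eK ->|eK]; first by rewrite (fintype.subsetP KD).
    by case: (e \in D) => //= /andP[/negbTE ->].
  rewrite selK eqxx andbT -/(sel x) selK Kk eqxx /=.
  apply/forallP => e; apply/implyP => eD; have := h e; rewrite /Q eD.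
  by case: ifP => [_|_ /andP[]//]; exact: ST.
rewrite -/(mass _ _) mass_all.
rewrite (bigID (mem K)) /=; congr (_ * _).
  rewrite (eq_bigr (fun=> a)) ?prodr_const ?Kk // => e eK.
  by rewrite /Q eK Sa // (fintype.subsetP KD).
rewrite (bigID (mem D)) /= [X in _ * X]big1 ?mulr1; last first.
  move=> e /andP[eK eD]; rewrite /Q (negbTE eK) (negbTE eD) /=.
  exact: mu_sum1.
rewrite (eq_bigr (fun=> 1 - a - b)); last first.
  move=> e /andP[eK eD]; rewrite /Q (negbTE eK) eD /=.
  have <- := mu_sum1 e; rewrite [in RHS](bigID S) /= (Sa e eD).
  rewrite [X in a + X - _](bigID T) /= [X in a + (X + _) - _](_ : _ = b).
    by ring.
  rewrite -(Tb e eD); apply: eq_bigl => z.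
  by case: (boolP (S z)) => // /ST /negbTE ->.
rewrite prodr_const; congr (_ ^+ _).
rewrite -Kk -cardsDS //; apply: eq_card => e.
by rewrite !inE.
Qed.

End ProductMeasure.

(** * The model as a product measure *)

Section Model.
Context {R : realType}.

Lemma bernoulli_pmf_sum1 (p : R) : \sum_b bernoulli_pmf p b = 1.
Proof. by rewrite big_bool /bernoulli_pmf /=; ring. Qed.

Lemma label_concentration (n : nat) (B : {set 'I_n}) (c : bool) (lam : R) :
  0 < lam -> (0 < #|B|)%N ->
  mass (@labels_pmf R n) (fun sigma : labels n => lam * (#|B|%:R * 2^-1)
     <= `| #|[set i in B | sigma i == c]|%:R - #|B|%:R * 2^-1 |)
  <= 2 / #|B|%:R / lam ^+ 2.
Proof.
move=> lam0 B0.
pose mu (i : 'I_n) := bernoulli_pmf (2^-1 : R).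
have mu0 i b : 0 <= mu i b by apply: bernoulli_pmf_ge0; lra.
have mu1 i : \sum_b mu i b = 1 by exact: bernoulli_pmf_sum1.
have dep i : depends_on [set i]
    (fun sigma : {ffun 'I_n -> bool} => (sigma i == c)%:R : R).
  by move=> x y xy; rewrite xy // inE.
have P1 i : mass (prod_pmf mu) (fun sigma => sigma i == c) = 2^-1.
  transitivity (mass (prod_pmf mu)
      (fun sigma => [forall j, (j == i) ==> (sigma j == c)])).
    apply: eq_bigl => x; apply/eqP/forallP => [xc j|/(_ i)].
      by apply/implyP => /eqP ->; apply/eqP.
    by rewrite eqxx => /eqP.
  rewrite (mass_all mu (fun j b => (j == i) ==> (b == c))).
  rewrite (bigD1 i) //= [X in _ * X]big1 ?mulr1; last first.
    by move=> j ji; rewrite -[RHS](mu1 j); apply: eq_bigl => b; rewrite (negbTE ji).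
  rewrite eqxx /= big_pred1_eq /mu /bernoulli_pmf.
  by case: c {dep}; lra.
have := @second_moment R _ _ (prod_pmf mu) B (fun i sigma => sigma i == c)
  2^-1 0 lam (prod_pmf_ge0 mu0) (prod_pmf_sum1 mu1).
rewrite mulr0 addr0 invfM invrK (mulrC _ 2); apply => //.
- by move=> u _; rewrite P1 subr0 mulr1 lexx.
move=> u v _ _ uv; rewrite (mass_indep mu1 (dep u) (dep v)).
  by rewrite !P1.
by move=> e; rewrite !inE => /eqP ->.
Qed.

(** The state of a vertex pair tells in which of the two subgraphs it is an
    edge.  The sum runs over its status in the parent graph. *)
Definition pair_pmf (p s : R) (z : bool * bool) : R :=
  \sum_(g : bool) bernoulli_pmf p g *
    (bernoulli_pmf (if g then s else 0) z.1 *
     bernoulli_pmf (if g then s else 0) z.2).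

Definition pair_graph (n : nat) := {ffun edge n -> bool * bool}.

Definition graph1 (n : nat) (x : pair_graph n) : graph n := [set e | (x e).1].
Definition graph2 (n : nat) (x : pair_graph n) : graph n := [set e | (x e).2].

Definition edge_pmf (n : nat) (p q s : R) (sigma : labels n) (e : edge n) :=
  pair_pmf (if same_label sigma e then p else q) s.

(** The second graph is recorded before relabelling, in the frame of the
    parent graph, together with the relabelling. *)
Definition config (n : nat) : finType :=
  (labels n * pair_graph n * {perm 'I_n})%type.

Definition config_pmf (n : nat) (p q s : R) (w : config n) : R :=
  labels_pmf w.1.1 * prod_pmf (edge_pmf p q s w.1.1) w.1.2 * (n`!%:R)^-1.

Definition obs (n : nat) (w : config n) : graph n * graph n :=
  (graph1 w.1.2, relabel w.2 (graph2 w.1.2)).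

(** Given the labels, the parent graph acts independently on vertex pairs, so
    it can be summed out pair by pair. *)
Lemma parent_marginal (n : nat) (p q s : R) (sigma : labels n)
    (G1 G2 : graph n) :
  \sum_(G : graph n)
    sbm_pmf p q sigma G * (subsample_pmf s G G1 * subsample_pmf s G G2)
  = \prod_e edge_pmf p q s sigma e (e \in G1, e \in G2).
Proof.
rewrite /edge_pmf /pair_pmf.
under [RHS]eq_bigr => e _ do rewrite big_bool /=.
rewrite bigA_distr /=; apply: eq_bigr => G _.
rewrite /sbm_pmf /subsample_pmf -!big_split /=; apply: eq_bigr => e _.
by case: (e \in G).
Qed.

Lemma csbm_prob_mass (n : nat) (p q s : R)
    (E : labels n -> graph n -> graph n -> bool) :
  csbm_prob p q s E
  = mass (config_pmf p q s) (fun w => E w.1.1 (obs w).1 (obs w).2).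
Proof.
rewrite massE /csbm_prob.
rewrite -(pair_big xpredT xpredT (fun a b => config_pmf p q s (a, b) *
   (E a.1 (obs (a, b)).1 (obs (a, b)).2)%:R)) /=.
rewrite -(pair_big xpredT xpredT (fun a b =>  \sum_pi config_pmf p q s (a, b, pi) *
   (E a (obs (a, b, pi)).1 (obs (a, b, pi)).2)%:R)) /=.
apply: eq_bigr => sigma _.
pose F (G1 G2 : graph n) : R := \sum_(pi : {perm 'I_n}) labels_pmf sigma *
   (\prod_e edge_pmf p q s sigma e (e \in G1, e \in G2)) * (n`!%:R)^-1
   * (E sigma G1 (relabel pi G2))%:R.
transitivity (\sum_(G1 : graph n) \sum_(G2 : graph n) F G1 G2).
  rewrite exchange_big; apply: eq_bigr => G1 _ /=.
  rewrite exchange_big; apply: eq_bigr => G2 _ /=.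
  rewrite exchange_big /= /F; rewrite [LHS]big_mkcond; apply: eq_bigr => pi _ /=.
  case: ifP => _; last by rewrite mulr0.
  rewrite mulr1 -parent_marginal mulr_sumr mulr_suml.
  by apply: eq_bigr => G _; rewrite /csbm_pmf (mulrA (labels_pmf _)).
rewrite pair_big /=.
rewrite (reindex (fun x : pair_graph n => (graph1 x, graph2 x))) /=; last first.
  exists (fun GG : graph n * graph n => [ffun e => (e \in GG.1, e \in GG.2)]).
    by move=> x _; apply/ffunP => e; rewrite ffunE !inE /=; case: (x e).
  move=> [G1 G2] _ /=; congr (_, _); apply/finset.setP => e;
    by rewrite !inE ffunE.
apply: eq_bigr => x _; rewrite /F /config_pmf /obs /=.
apply: eq_bigr => pi _; congr (_ * _ * _ * _).
by apply: eq_bigr => e _; rewrite !inE; case: (x e).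
Qed.

End Model.

(** * Exchanging two labels *)

Section Exchange.
Context {R : realType}.

(** Charge the weight of a configuration x counted on the left to the
    configurations mv j x with j admissible.  Each of these has at least the
    weight of x, and each configuration is charged at most twice. *)
Lemma exchange_bound (T J : finType) (w : T -> R) (mv : J -> T -> T)
    (ok : J -> pred T) (A : pred T) (K : R) :
  (forall x, 0 <= w x) -> \sum_x w x = 1 ->
  (forall j, involutive (mv j)) ->
  (forall j x, ok j x -> w x <= w (mv j x)) ->
  (forall x, (#|[set j | A (mv j x) && ok j (mv j x)]| <= 2)%N) -> 0 < K ->
  mass w (fun x => A x && (K <= #|[set j | ok j x]|%:R)) <= 2 / K.
Proof.
move=> w0 w1 mvK okw card2 K0; rewrite ler_pdivlMr //.
have cardE (P : pred J) : #|[set j | P j]|%:R = \sum_j (P j)%:R :> R.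
  rewrite -sum1_card natr_sum big_mkcond /=.
  by apply: eq_bigr => j _; rewrite inE; case: (P j).
apply: (@le_trans _ _ (\sum_(x | A x) \sum_j w x * (ok j x)%:R)).
  rewrite /mass mulr_suml big_mkcondr /=; apply: ler_sum => x _.
  rewrite -mulr_sumr -cardE; case: ifP => [Kx|_].
    exact: ler_wpM2l.
  exact: mulr_ge0.
(* Replace the weight of x by the weight of its image, then reindex by it. *)
apply: (@le_trans _ _ (\sum_j \sum_(x | A x && ok j x) w (mv j x))).
  rewrite exchange_big /=; apply: ler_sum => j _.
  rewrite big_mkcondr; apply: ler_sum => x _.
  by case: (boolP (ok j x)) => [/okw|]; rewrite ?mulr1 ?mulr0.
apply: (@le_trans _ _ (\sum_x w x * #|[set j | A (mv j x) && ok j (mv j x)]|%:R)).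
  under [leRHS]eq_bigr do rewrite cardE mulr_sumr.
  rewrite [leRHS]exchange_big /=; apply: ler_sum => j _.
  rewrite (reindex_inj (inv_inj (mvK j))) /= big_mkcond /=.
  by apply: ler_sum => x _; rewrite mvK; case: (_ && _); rewrite ?mulr1 ?mulr0.
have -> : 2 = \sum_x w x * 2 by rewrite -mulr_suml w1 mul1r.
apply: ler_sum => x _.
by apply: ler_wpM2l => //; rewrite ler_nat.
Qed.

Lemma overlap_eq1 (n : nat) (f g : labels n) :
  overlap f g == 1 :> R -> g = f \/ g = [ffun i => ~~ f i].
Proof.
rewrite /overlap => /eqP ov.
pose e i : R := label_sign R (f i) * label_sign R (g i).
have n0 : n%:R != 0 :> R.
  by apply: contra_eq_neq ov => ->; rewrite invr0 mul0r eq_sym oner_eq0.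
have abs_sum : `|\sum_i e i| = n%:R.
  by apply: (mulfI (invr_neq0 n0)); rewrite mulVf.
have eE i : e i = if f i == g i then 1 else -1.
  by rewrite /e /label_sign; case: (f i); case: (g i) => /=;
    rewrite ?expr0 ?expr1 ?mulr1 ?mul1r ?mulrNN ?mulr1.
have nE : n%:R = \sum_(i < n) (1 : R).
  by rewrite sumr_const card_ord.
have [s0|s0] := lerP 0 (\sum_i e i); [left|right].
  rewrite ger0_norm // in abs_sum.
  have : \sum_i (1 - e i) == 0 by rewrite sumrB -nE abs_sum subrr.
  rewrite psumr_eq0; last by move=> i _; rewrite eE; case: ifP; lra.
  move=> /allP h; apply/ffunP => i; have := h i (mem_index_enum i).
  by rewrite eE; case: (f i =P g i) => //= _ /eqP h1; exfalso; lra.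
rewrite ltr0_norm // in abs_sum.
have : \sum_i (1 + e i) == 0 by rewrite big_split /= -nE -abs_sum addNr.
rewrite psumr_eq0; last by move=> i _; rewrite eE; case: ifP; lra.
move=> /allP h; apply/ffunP => i; have := h i (mem_index_enum i).
rewrite eE ffunE; case: (f i =P g i) => [_ /eqP h1|]; first by exfalso; lra.
by case: (f i); case: (g i).
Qed.

End Exchange.

Section Edges.
Variable n : nat.
Implicit Types (u v : 'I_n) (e : edge n) (sigma : labels n).

Definition ends e : {set 'I_n} := val e.

Lemma card_ends e : #|ends e| == 2%N.
Proof. exact: (valP e). Qed.

Lemma ends_inj : injective ends.
Proof. exact: val_inj. Qed.

Lemma ends_relabel (pi : {perm 'I_n}) e : ends (relabel_edge pi e) = pi @: ends e.
Proof. by []. Qed.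

Lemma same_labelP sigma e :
  reflect {in ends e &, forall i j, sigma i = sigma j} (same_label sigma e).
Proof.
apply: (iffP forallP) => [h i j ie je|h i].
  have /implyP/(_ ie)/forallP/(_ j)/implyP/(_ je) := h i.
  exact: eqP.
by apply/implyP => ie; apply/forallP => j; apply/implyP => je; apply/eqP/h.
Qed.

Lemma edge_other u e : u \in ends e ->
  exists2 w, w != u & ends e = [set u; w].
Proof.
move=> ue; have /cards2P[a [b [ab eab]]] := card_ends e.
move: ue; rewrite eab !inE => /orP[] /eqP ->.
  by exists b => //; rewrite eq_sym.
by exists a => //; rewrite finset.setUC.
Qed.

Lemma same_label_set2 sigma e a b :
  ends e = [set a; b] -> same_label sigma e = (sigma a == sigma b).
Proof.
move=> eab; apply/same_labelP/eqP; rewrite eab.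
  by apply; rewrite !inE eqxx ?orbT.
by move=> ab i j; rewrite !inE => /orP[] /eqP -> /orP[] /eqP ->.
Qed.

Definition swap_labels u v sigma : labels n :=
  [ffun i => sigma (tperm u v i)].

Lemma swap_labelsK u v : involutive (swap_labels u v).
Proof. by move=> s; apply/ffunP => i; rewrite !ffunE tpermK. Qed.

Definition swap_edge u v : edge n -> edge n := relabel_edge (tperm u v).

Lemma in_swap_edge u v e i :
  (i \in ends (swap_edge u v e)) = (tperm u v i \in ends e).
Proof.
by rewrite ends_relabel -{1}(tpermK u v i) mem_imset //; exact: perm_inj.
Qed.

Lemma swap_edgeK u v : involutive (swap_edge u v).
Proof.
by move=> e; apply: ends_inj; apply/finset.setP => i; rewrite !in_swap_edge tpermK.
Qed.

Lemma same_label_swap u v sigma e :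
  same_label (swap_labels u v sigma) e = same_label sigma (swap_edge u v e).
Proof.
have /cards2P[a [b [ab eab]]] := card_ends e.
rewrite (same_label_set2 _ eab) !ffunE.
rewrite (@same_label_set2 _ _ (tperm u v a) (tperm u v b)) //.
by rewrite ends_relabel eab imsetU1 imset_set1.
Qed.

Lemma swap_edge_id u v e :
  (u \in ends e) = (v \in ends e) -> swap_edge u v e = e.
Proof.
move=> uv; apply: ends_inj; apply/finset.setP => i; rewrite in_swap_edge.
by case: tpermP => [->|->|].
Qed.

(** The vertices u and v have opposite labels, so the third vertex involved
    agrees with exactly one of them. *)
Lemma same_label_flip u v sigma e : sigma u != sigma v ->
  u \in ends e -> v \notin ends e ->
  same_label sigma (swap_edge u v e) = ~~ same_label sigma e.
Proof.
move=> suv /edge_other[w wu ew] ve.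
rewrite -same_label_swap !(same_label_set2 _ ew) !ffunE tpermL.
have wv : v != w by apply: contra ve => /eqP ->; rewrite ew !inE eqxx orbT.
rewrite tpermD // 1?eq_sym //.
by move: suv; case: (sigma u); case: (sigma v); case: (sigma w).
Qed.

(** Each pair that contains u but not v is grouped with its image, which
    contains v but not u; the transposition fixes all other pairs. *)
Lemma prod_swap_edge {R : comPzRingType} u v (F : edge n -> R) :
  \prod_e F e
  = \prod_(e | (u \in ends e) && (v \notin ends e)) (F e * F (swap_edge u v e))
    * \prod_(e | (u \in ends e) == (v \in ends e)) F e.
Proof.
rewrite (bigID (fun e => (u \in ends e) == (v \in ends e))) /= mulrC.
congr (_ * _); rewrite (bigID (fun e => u \in ends e)) /= big_split /=.
congr (_ * _).
  by apply: eq_bigl => e; case: (u \in _); case: (v \in _).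
rewrite (reindex_inj (inv_inj (swap_edgeK u v))) /=; apply: eq_bigl => e.
rewrite !in_swap_edge tpermL tpermR.
by case: (u \in _); case: (v \in _).
Qed.

End Edges.

(** * Exchanges that do not decrease the weight *)

Section SwapMove.
Context {R : realType}.

Lemma prod_expr_bool (I : finType) (P c phi : pred I) (r : bool -> R) :
  \prod_(i | P i) r (c i) ^+ phi i
  = r true ^+ #|[set i | [&& P i, c i & phi i]]|
    * r false ^+ #|[set i | [&& P i, ~~ c i & phi i]]|.
Proof.
have aux (Q : pred I) b : \prod_(i | Q i) r b ^+ phi i
    = r b ^+ #|[set i | Q i && phi i]|.
  rewrite -prodr_const big_mkcond [RHS]big_mkcond /=; apply: eq_bigr => i _.
  by rewrite inE; case: (Q i); case: (phi i).
rewrite (bigID c) /=; congr (_ * _).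
  rewrite (eq_bigr (fun i => r true ^+ phi i)) => [|i /andP[_ ->] //].
  by rewrite aux; congr (_ ^+ _); apply: eq_card => i; rewrite !inE -andbA.
rewrite (eq_bigr (fun i => r false ^+ phi i)) => [|i /andP[_ /negbTE ->] //].
by rewrite aux; congr (_ ^+ _); apply: eq_card => i; rewrite !inE -andbA.
Qed.

Lemma prod_expr_balanced (I : finType) (P c phi : pred I) (r : bool -> R) :
  #|[set i | [&& P i, c i & phi i]]| = #|[set i | [&& P i, ~~ c i & phi i]]| ->
  \prod_(i | P i) r (c i) ^+ phi i = \prod_(i | P i) r (~~ c i) ^+ phi i.
Proof.
move=> bal; rewrite prod_expr_bool (prod_expr_bool P (fun i => ~~ c i)) bal.
congr (_ * _ ^+ _); rewrite -bal; apply: eq_card => i.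
by rewrite !inE negbK.
Qed.

Variables (n : nat) (S T : pred (bool * bool)).
Variable up : bool * bool -> bool * bool -> bool * bool.
Implicit Types (sigma : labels n) (x : pair_graph n) (u v : 'I_n).

Definition swap_states u v x : pair_graph n :=
  [ffun e => up (x e) (x (swap_edge u v e))].

(** The equality of the two counts makes a likelihood insensitive to the label
    of u when it depends on the states only through S. *)
Definition balanced sigma x u :=
  (#|[set e | [&& u \in ends e, same_label sigma e & S (x e)]]|
   == #|[set e | [&& u \in ends e, ~~ same_label sigma e & S (x e)]]|)
  && [forall e, (u \in ends e) ==> ~~ T (x e)].

Definition swappable sigma x u v :=
  [&& ~~ sigma u, sigma v, balanced sigma x u, balanced sigma x v &
      [forall e, (u \in ends e) && (v \in ends e) ==> ~~ S (x e)]].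

(** M true and M false are the laws of the state of a pair inside a community
    and across communities.  After the exchange the pair {u, w} has state
    [up z z'] and the pair {v, w} has state [up z' z], and their types are
    interchanged.  The inequality says that, away from T, the only loss is the
    exchange of the odds r c and r (~~ c) of a hit; that loss disappears when
    the factors are multiplied over all w, for balanced u and v. *)
Definition local_exchange (M : bool -> bool * bool -> R) : Prop :=
  exists (r : bool -> R) (N : bool -> bool * bool -> bool * bool -> R),
  (forall c, 0 <= r c) /\
  forall c z z', ~~ T z -> ~~ T z' ->
  [/\ 0 <= N c z z',
      M c z * M (~~ c) z' = N c z z' * (r c ^+ S z * r (~~ c) ^+ S z') &
      N c z z' * (r (~~ c) ^+ S z * r c ^+ S z')
      <= M (~~ c) (up z z') * M c (up z' z)].

Hypothesis up_id : forall z, up z z = z.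

(** Only the pairs that contain exactly one of u and v change their law.  They
    come in couples {u, w}, {v, w}, for which [local_exchange] applies; the
    remaining powers of r match by balance at u and at v separately. *)
Lemma swap_states_weight (p q s : R) sigma x u v :
  (forall c z, 0 <= pair_pmf (if c then p else q) s z) ->
  local_exchange (fun c => pair_pmf (if c then p else q) s) ->
  swappable sigma x u v ->
  prod_pmf (edge_pmf p q s sigma) x
  <= prod_pmf (edge_pmf p q s (swap_labels u v sigma)) (swap_states u v x).
Proof.
set M := fun c => pair_pmf _ s => M0 [r [N [r0 HN]]].
case/and5P => su sv /andP[/eqP balu /forallP Tu] /andP[/eqP balv /forallP Tv].
move=> /forallP Suv.
have suv : sigma u != sigma v by rewrite (negbTE su) sv.
have MN e : edge_pmf p q s sigma e =1 M (same_label sigma e) by [].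
have MN' e : edge_pmf p q s (swap_labels u v sigma) e
    =1 M (same_label sigma (swap_edge u v e)).
  by move=> z; rewrite /edge_pmf same_label_swap.
rewrite /prod_pmf (prod_swap_edge u v) [leRHS](prod_swap_edge u v).
have -> : \prod_(e | (u \in ends e) == (v \in ends e))
     edge_pmf p q s (swap_labels u v sigma) e (swap_states u v x e)
   = \prod_(e | (u \in ends e) == (v \in ends e)) edge_pmf p q s sigma e (x e).
  by apply: eq_bigr => e /eqP uve; rewrite MN' MN ffunE swap_edge_id // up_id.
apply: ler_wpM2r; first by apply: prodr_ge0 => e _; exact: M0.
pose c e := same_label sigma e.
pose t := swap_edge u v.
have tK : involutive t := swap_edgeK u v.
pose P e := (u \in ends e) && (v \notin ends e).
have ct e : P e -> c (t e) = ~~ c e.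
  by case/andP => ue ve; exact: same_label_flip.
have NT e : P e -> ~~ T (x e).
  by case/andP => ue _; have /implyP := Tu e; apply.
have NTt e : P e -> ~~ T (x (t e)).
  case/andP => ue _; have /implyP := Tv (t e); apply.
  by rewrite in_swap_edge tpermR.
have LE : \prod_(e | P e) (N (c e) (x e) (x (t e))
    * (r (~~ c e) ^+ S (x e) * r (c e) ^+ S (x (t e))))
  <= \prod_(e | P e) (edge_pmf p q s (swap_labels u v sigma) e (swap_states u v x e)
     * edge_pmf p q s (swap_labels u v sigma) (t e) (swap_states u v x (t e))).
  apply: ler_prod => e Pe; have [N0 _ NM] := HN (c e) _ _ (NT e Pe) (NTt e Pe).
  rewrite !MN' !ffunE -/t tK -/(c (t e)) -/(c e) ct // NM andbT.
  by rewrite !mulr_ge0 // exprn_ge0.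
apply: le_trans LE; rewrite le_eqVlt; apply/orP; left; apply/eqP.
have -> : \prod_(e | P e) (edge_pmf p q s sigma e (x e)
     * edge_pmf p q s sigma (t e) (x (t e)))
   = \prod_(e | P e) (N (c e) (x e) (x (t e))
    * (r (c e) ^+ S (x e) * r (~~ c e) ^+ S (x (t e)))).
  apply: eq_bigr => e Pe; have [_ <- _] := HN (c e) _ _ (NT e Pe) (NTt e Pe).
  by rewrite !MN -/(c _) -/(c (t e)) ct.
rewrite !big_split /=; congr (_ * (_ * _)).
  apply: (prod_expr_balanced (c := c) (phi := fun e => S (x e))).
  transitivity #|[set e | [&& u \in ends e, c e & S (x e)]]|; last first.
    rewrite balu; apply: eq_card => e; rewrite !inE /P.
    have := Suv e; case: (u \in _); case: (v \in _); case: (S _) => //=.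
    by rewrite andbF.
  apply: eq_card => e; rewrite !inE /P.
  have := Suv e; case: (u \in _); case: (v \in _); case: (S _) => //=.
  by rewrite andbF.
pose P' e := (v \in ends e) && (u \notin ends e).
have PP' e : P (t e) = P' e by rewrite /P /P' !in_swap_edge tpermL tpermR.
transitivity (\prod_(e | P' e) r (c e) ^+ S (x e)).
  rewrite [RHS](reindex_inj (inv_inj (swap_edgeK u v))) /=.
  apply: eq_big => [e|e Pe]; last by rewrite -/(t e) ct.
  by rewrite -PP' -/(t e) tK.
transitivity (\prod_(e | P' e) r (~~ c e) ^+ S (x e)); last first.
  rewrite [LHS](reindex_inj (inv_inj (swap_edgeK u v))) /=.
  apply: eq_big => [e|e Pe]; first by rewrite -PP' -/(t e) tK.
  by move: Pe; rewrite -/(t e) -PP' tK => Pe; rewrite ct ?negbK.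
apply: (prod_expr_balanced (c := c) (phi := fun e => S (x e))).
transitivity #|[set e | [&& v \in ends e, c e & S (x e)]]|; last first.
  rewrite balv; apply: eq_card => e; rewrite !inE /P'.
  have := Suv e; case: (u \in _); case: (v \in _); case: (S _) => //=.
  by rewrite andbF.
apply: eq_card => e; rewrite !inE /P'.
have := Suv e; case: (u \in _); case: (v \in _); case: (S _) => //=.
by rewrite andbF.
Qed.

End SwapMove.

(** * The recovery bound for the two kinds of exchange *)

Section Recovery.
Context {R : realType}.
Implicit Types (p q s : R).

Lemma pair_pmfE p s (z : bool * bool) :
  pair_pmf p s z = if z == (false, false) then 1 - p * (1 - (1 - s) ^+ 2)
                   else p * (s ^+ (z.1 + z.2) * (1 - s) ^+ (2 - (z.1 + z.2))).
Proof.
rewrite /pair_pmf big_bool /bernoulli_pmf /=.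
by case: z => [[] []] /=; rewrite ?expr0 ?expr1; ring.
Qed.

Lemma pair_pmf_ge0 p s z : 0 <= p <= 1 -> 0 <= s <= 1 -> 0 <= pair_pmf p s z.
Proof.
move=> p01 s01; apply: sumr_ge0 => g _; rewrite mulr_ge0 ?bernoulli_pmf_ge0 //.
have g01 : 0 <= (if g then s else 0) <= 1 by case: g => //; rewrite lexx ler01.
by rewrite mulr_ge0 // bernoulli_pmf_ge0.
Qed.

Lemma pair_pmf_sum1 p s : \sum_z pair_pmf p s z = 1.
Proof.
rewrite -(pair_big xpredT xpredT (fun a b => pair_pmf p s (a, b))) /=.
by rewrite !big_bool /= !pair_pmfE /=; ring.
Qed.

Lemma edge_pmf_ge0 n p q s (sigma : labels n) e z :
  0 <= p <= 1 -> 0 <= q <= 1 -> 0 <= s <= 1 -> 0 <= edge_pmf p q s sigma e z.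
Proof. by move=> ? ? ?; apply: pair_pmf_ge0 => //; case: ifP. Qed.

Lemma edge_pmf_sum1 n p q s (sigma : labels n) e :
  \sum_z edge_pmf p q s sigma e z = 1.
Proof. exact: pair_pmf_sum1. Qed.

Lemma labels_pmf_sum1 n : \sum_sigma @labels_pmf R n sigma = 1.
Proof.
exact: (@prod_pmf_sum1 R _ _ (fun=> bernoulli_pmf 2^-1)
  (fun=> bernoulli_pmf_sum1 _)).
Qed.

Lemma labels_pmf_ge0 n (sigma : labels n) : 0 <= labels_pmf sigma :> R.
Proof. by apply: prodr_ge0 => i _; apply: bernoulli_pmf_ge0; lra. Qed.

Lemma labels_pmf_swap n u v (sigma : labels n) :
  labels_pmf (swap_labels u v sigma) = labels_pmf sigma :> R.
Proof.
rewrite /labels_pmf [RHS](reindex_inj (@perm_inj _ (tperm u v))) /=.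
by apply: eq_bigr => i _; rewrite ffunE.
Qed.

Lemma mass_config n p q s (P : labels n -> pred (pair_graph n)) :
  mass (config_pmf p q s) (fun w => P w.1.1 w.1.2)
  = \sum_sigma labels_pmf sigma * mass (prod_pmf (edge_pmf p q s sigma)) (P sigma).
Proof.
rewrite massE -(pair_big xpredT xpredT (fun a b => config_pmf p q s (a, b) *
   (P a.1 a.2)%:R)) /=.
rewrite -(pair_big xpredT xpredT (fun a b =>
  \sum_pi config_pmf p q s (a, b, pi) * (P a b)%:R)) /=.
apply: eq_bigr => sigma _; rewrite massE mulr_sumr; apply: eq_bigr => x _.
rewrite /config_pmf /= sumr_const card_Sn -mulr_natl.
have n0 : n`!%:R != 0 :> R by rewrite pnatr_eq0 -lt0n fact_gt0.
by field.
Qed.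

Lemma config_pmf_sum1 n p q s : \sum_w @config_pmf R n p q s w = 1.
Proof.
rewrite (_ : \sum_w _ = mass (config_pmf p q s) (fun w : config n => true)) //.
rewrite (mass_config p q s (fun _ _ => true)) -[RHS](labels_pmf_sum1 n).
apply: eq_bigr => sigma _; rewrite /mass prod_pmf_sum1 ?mulr1 //.
by move=> e; exact: edge_pmf_sum1.
Qed.

Lemma config_pmf_ge0 n p q s (w : config n) :
  0 <= p <= 1 -> 0 <= q <= 1 -> 0 <= s <= 1 -> 0 <= config_pmf p q s w.
Proof.
move=> p01 q01 s01; rewrite /config_pmf !mulr_ge0 ?invr_ge0 ?ler0n //.
  exact: labels_pmf_ge0.
by apply: prod_pmf_ge0 => e z; exact: edge_pmf_ge0.
Qed.

Definition hidden_move n (up : bool * bool -> bool * bool -> bool * bool)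
    (mv : 'I_n * 'I_n -> config n -> config n) : Prop :=
  forall j, involutive (mv j) /\ forall w,
   obs (mv j w) = obs w /\
   (mv j w).1 = (swap_labels j.1 j.2 w.1.1, swap_states up j.1 j.2 w.1.2).

(** For a given configuration and a given sign, the labels before the exchange
    are the estimate up to that sign.  They differ from the present ones exactly
    at u and v, and the labels of u and v tell which is which.  Hence at most
    two exchanges lead from a configuration of success to the given one. *)
Lemma recovery_le n p q s (S T : pred (bool * bool)) up
    (mv : 'I_n * 'I_n -> config n -> config n)
    (est : graph n -> graph n -> labels n) (K : R) :
  0 <= p <= 1 -> 0 <= q <= 1 -> 0 <= s <= 1 ->
  (forall z, up z z = z) ->
  local_exchange S T up (fun c => pair_pmf (if c then p else q) s) ->
  hidden_move up mv -> 0 < K ->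
  mass (config_pmf p q s) (fun w =>
     (overlap (est (obs w).1 (obs w).2) w.1.1 == 1 :> R)
     && (K <= #|[set j | swappable S T w.1.1 w.1.2 j.1 j.2]|%:R)) <= 2 / K.
Proof.
move=> p01 q01 s01 up_id HN mvP K0.
apply: (exchange_bound (mv := mv)
  (ok := fun j w => swappable S T w.1.1 w.1.2 j.1 j.2)) => //.
- by move=> w; exact: config_pmf_ge0.
- exact: config_pmf_sum1.
- by move=> j; case: (mvP j).
- move=> j w ok; have [_ /(_ w)[_ mvE]] := mvP j.
  rewrite /config_pmf mvE /= labels_pmf_swap.
  apply: ler_wpM2r; first by rewrite invr_ge0 ler0n.
  apply: ler_wpM2l; first exact: labels_pmf_ge0.
  apply: (swap_states_weight up_id _ HN ok) => c z.
  by apply: pair_pmf_ge0 => //; case: c.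
move=> w; set f := est (obs w).1 (obs w).2.
set J := [set j | _].
pose g (j : 'I_n * 'I_n) := swap_labels j.1 j.2 w.1.1.
have JP j : j \in J -> [/\ w.1.1 j.1, ~~ w.1.1 j.2 &
    g j = f \/ g j = [ffun i => ~~ f i]].
  rewrite inE; have [_ /(_ w)[obsE mvE]] := mvP j.
  rewrite obsE mvE /= -/f => /andP[/overlap_eq1 ov /and5P[]].
  by rewrite !ffunE tpermL tpermR => -> -> _ _ _; split.
have gP j i : j \in J -> w.1.1 i -> ~~ g j i -> i = j.1.
  move=> /JP[j1 j2 _] wi; rewrite ffunE; case: tpermP => [->|ij|] //.
    by move: wi; rewrite ij (negbTE j2).
  by rewrite wi.
have gP' j i : j \in J -> ~~ w.1.1 i -> g j i -> i = j.2.
  move=> /JP[j1 j2 _] wi; rewrite ffunE; case: tpermP => [ij|->|] //.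
    by move: wi; rewrite ij j1.
  by rewrite (negbTE wi).
have g_inj : {in J &, injective g}.
  move=> j j' jJ j'J gg.
  have [j1 j2 _] := JP j jJ.
  rewrite [j]surjective_pairing [j']surjective_pairing; congr (_, _).
    apply: (gP j') => //; rewrite -gg ffunE tpermL //.
  by apply: (gP' j') => //; rewrite -gg ffunE tpermR.
rewrite -(card_in_imset g_inj).
apply: (@leq_trans #|[set f; [ffun i => ~~ f i] : labels n]|).
  apply: subset_leq_card; apply/fintype.subsetP => _ /imsetP[j /JP[_ _ H] ->].
  by rewrite !inE; case: H => ->; rewrite eqxx ?orbT.
by rewrite cards2; case: eqP.
Qed.

Lemma relabelM n (a b : {perm 'I_n}) (G : graph n) :
  relabel (a * b)%g G = relabel b (relabel a G).
Proof.
rewrite /relabel -imset_comp; apply: eq_imset => e /=; apply: ends_inj.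
rewrite !ends_relabel -imset_comp.
by apply: eq_imset => i /=; rewrite permM.
Qed.

Definition keep_states (z z' : bool * bool) := z.
Definition swap_second (z z' : bool * bool) := (z.1, z'.2).

Lemma relabelled_move n : hidden_move keep_states
  (fun (j : 'I_n * 'I_n) (w : config n) =>
     (swap_labels j.1 j.2 w.1.1, swap_states keep_states j.1 j.2 w.1.2, w.2)).
Proof.
move=> [u v]; have idE (x : pair_graph n) : swap_states keep_states u v x = x.
  by apply/ffunP => e; rewrite ffunE.
by split => [[[sigma x] pi]|[[sigma x] pi]] /=; rewrite ?idE ?swap_labelsK.
Qed.

(** Moving the vertices of the second graph and composing the alignment with
    the same transposition cancel out in the relabelled graph. *)
Lemma realigned_move n : hidden_move swap_second
  (fun (j : 'I_n * 'I_n) (w : config n) =>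
     (swap_labels j.1 j.2 w.1.1, swap_states swap_second j.1 j.2 w.1.2,
      (tperm j.1 j.2 * w.2)%g)).
Proof.
move=> [u v]; split => [[[sigma x] pi]|[[sigma x] pi]] /=.
  rewrite swap_labelsK mulgA tperm2 mul1g; congr (_, _, _).
  by apply/ffunP => e; rewrite !ffunE /swap_second /= swap_edgeK; case: (x e).
split=> //; rewrite /obs /= relabelM; congr (_, relabel _ _).
  by apply/finset.setP => e; rewrite !inE ffunE.
apply/finset.setP => e; apply/imsetP/idP => [[e']|].
  by rewrite !inE ffunE /= => ? ->.
rewrite inE => xe; exists (swap_edge u v e); last first.
  by rewrite -/(swap_edge u v _) swap_edgeK.
by rewrite inE ffunE /= swap_edgeK.
Qed.

(** A nonzero state has probability proportional to the edge probability, with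
    a factor nu that does not depend on the labels.  The odds r c compare its
    probability with that of the zero state. *)
Lemma union_exchange p q s :
  0 <= p <= 1 -> 0 <= q <= 1 -> 0 <= s <= 1 ->
  0 < 1 - p * (1 - (1 - s) ^+ 2) -> 0 < 1 - q * (1 - (1 - s) ^+ 2) ->
  local_exchange (fun z => z != (false, false)) pred0 keep_states
    (fun c => pair_pmf (if c then p else q) s).
Proof.
move=> p01 q01 s01 Bp Bq.
pose P (c : bool) := if c then p else q.
pose B c : R := 1 - P c * (1 - (1 - s) ^+ 2).
have B0 c : 0 < B c by case: c.
have P0 c : 0 <= P c by case: c; [case/andP: p01 | case/andP: q01].
pose nu (z : bool * bool) := if z == (false, false) then 1 else
  s ^+ (z.1 + z.2) * (1 - s) ^+ (2 - (z.1 + z.2)).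
have nu0 z : 0 <= nu z.
  by rewrite /nu; case: ifP => // _; rewrite mulr_ge0 ?exprn_ge0 //; lra.
have ME c (z : bool * bool) : pair_pmf (P c) s z = B c * (P c / B c) ^+ (z != (false, false)) * nu z.
  rewrite pair_pmfE /nu; case: eqP => /= _; first by rewrite expr0 !mulr1.
  by rewrite expr1 [B c * _]mulrC divfK ?gt_eqF.
exists (fun c => P c / B c), (fun c z z' => B c * B (~~ c) * nu z * nu z').
split=> [c|c z z' _ _]; first by rewrite divr_ge0 // ltW.
rewrite /keep_states -/(P c) -/(P (~~ c)) !ME.
split; first by rewrite !mulr_ge0 // ltW.
  by rewrite !mulrA; ring.
by rewrite le_eqVlt; apply/orP; left; apply/eqP; ring.
Qed.

(** Apart from (true, true) the two components of a state behave as if they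
    were independent with the same odds r c, and the probability of
    (true, true) is at least what this product form predicts, because p <= 1.
    So the product form can be used as a lower bound after the exchange, where
    common edges may have appeared, and as an equality before it. *)
Lemma intersection_exchange p q s :
  0 <= p <= 1 -> 0 <= q <= 1 -> 0 <= s <= 1 ->
  0 < 1 - p * (1 - (1 - s) ^+ 2) -> 0 < 1 - q * (1 - (1 - s) ^+ 2) ->
  local_exchange (fun z => z == (true, false)) (fun z => z == (true, true))
    swap_second (fun c => pair_pmf (if c then p else q) s).
Proof.
move=> p01 q01 s01 Bp Bq.
pose P (c : bool) := if c then p else q.
pose B c : R := 1 - P c * (1 - (1 - s) ^+ 2).
have B0 c : 0 < B c by case: c.
have P0 c : 0 <= P c <= 1 by case: c.
pose r c := P c * (s * (1 - s)) / B c.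
have r0 c : 0 <= r c.
  rewrite divr_ge0 ?(ltW (B0 _)) // mulr_ge0 //; first by case/andP: (P0 c).
  by rewrite mulr_ge0 //; lra.
have ME c (z : bool * bool) : z != (true, true) ->
    pair_pmf (P c) s z = B c * (r c ^+ z.1 * r c ^+ z.2).
  have rE : B c * r c = P c * (s * (1 - s)).
    by rewrite /r mulrC divfK ?gt_eqF.
  rewrite pair_pmfE; case: z => [[] []] //= _;
    by rewrite ?expr0 ?expr1 ?mulr1 ?mul1r ?rE.
have Mle c (z : bool * bool) : B c * (r c ^+ z.1 * r c ^+ z.2) <= pair_pmf (P c) s z.
  have [->|zT] := eqVneq z (true, true); last by rewrite ME.
  rewrite pair_pmfE /= !expr1 /r.
  have -> : B c * (P c * (s * (1 - s)) / B c * (P c * (s * (1 - s)) / B c))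
     = (P c * (s * (1 - s))) ^+ 2 / B c.
    by field; rewrite gt_eqF.
  rewrite ler_pdivrMr // expr0 mulr1 -subr_ge0.
  have -> : P c * s ^+ 2 * B c - (P c * (s * (1 - s))) ^+ 2
     = P c * s ^+ 2 * (1 - P c) by rewrite /B; ring.
  case/andP: (P0 c) => c0 c1.
  apply: mulr_ge0; last by rewrite subr_ge0.
  by apply: mulr_ge0 => //; exact: sqr_ge0.
exists r, (fun c (z z' : bool * bool) => B c * B (~~ c) * r c ^+ z.2 * r (~~ c) ^+ z'.2).
split=> // c z z' zT zT'.
have SE (z1 : bool * bool) : z1 != (true, true) -> (z1 == (true, false)) = z1.1 by case: z1 => [[] []].
rewrite -/(P c) -/(P (~~ c)) !SE //; split.
- by rewrite !mulr_ge0 ?exprn_ge0 // ltW.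
- by rewrite !ME //; ring.
have := Mle (~~ c) (swap_second z z'); have := Mle c (swap_second z' z).
rewrite /swap_second /= => le1 le2.
apply: le_trans (ler_pM _ _ le2 le1).
- by rewrite le_eqVlt; apply/orP; left; apply/eqP; ring.
- by rewrite !mulr_ge0 ?exprn_ge0 // ltW.
by rewrite !mulr_ge0 ?exprn_ge0 // ltW.
Qed.

End Recovery.

(** * Vertices that can be exchanged *)

Section GoodVertices.
Context {R : realType}.

Definition binomial_term (M k : nat) (a b : R) : R :=
  a ^+ k * (1 - a - b) ^+ (M - k) *+ 'C(M, k).

Lemma bernoulli_ineq (h : R) (m : nat) : 0 <= h <= 1 -> 1 - m%:R * h <= (1 - h) ^+ m.
Proof.
move=> h01; elim: m => [|m IH]; first by rewrite expr0 mul0r subr0.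
rewrite exprS -natr1; have : 0 <= m%:R :> R by [].
have : (1 - h) * (1 - m%:R * h) <= (1 - h) * (1 - h) ^+ m.
  by apply: ler_wpM2l => //; lra.
nra.
Qed.

Variables (n : nat) (sigma : labels n) (V0 : {set 'I_n}).
Variables (S T : pred (bool * bool)) (p q s kS kT : R) (k : nat).
Hypothesis S00 : ~~ S (false, false).
Hypothesis T00 : ~~ T (false, false).
Hypothesis ST : forall z, S z -> ~~ T z.
Hypothesis p01 : 0 <= p <= 1.
Hypothesis q01 : 0 <= q <= 1.
Hypothesis s01 : 0 <= s <= 1.
Hypothesis massS : forall p', \sum_(z | S z) pair_pmf p' s z = p' * kS.
Hypothesis massT : forall p', \sum_(z | T z) pair_pmf p' s z = p' * kT.
Implicit Types (u v : 'I_n) (x : pair_graph n) (b c : bool).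

Let W := prod_pmf (edge_pmf p q s sigma).
Let mu1 := edge_pmf_sum1 p q s sigma.
Let mu0 e z : 0 <= edge_pmf p q s sigma e z.
Proof. exact: edge_pmf_ge0. Qed.

(** For distinct vertices of V0 these
    sets are disjoint, which is what makes the profiles independent. *)
Definition bulk u b : {set edge n} :=
  [set e | [&& u \in ends e, same_label sigma e == b & ~~ (ends e \subset V0)]].

Definition inner u : {set edge n} :=
  [set e | (u \in ends e) && (ends e \subset V0)].

Definition profile u b x :=
  (#|[set e in bulk u b | S (x e)]| == k)
  && [forall e in bulk u b, ~~ T (x e)].

(** The edges inside V0 are required to be absent altogether, so that the
    balance of u is decided by its bulk edges, and so that two good vertices
    are not joined to each other. *)
Definition good u x :=
  (profile u true x && profile u false x)
  && [forall e in inner u, x e == (false, false)].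

Definition outer c : {set 'I_n} := [set w in ~: V0 | sigma w == c].

Definition good_prob c : R :=
  binomial_term #|outer c| k (p * kS) (p * kT)
  * binomial_term #|outer (~~ c)| k (q * kS) (q * kT).

Lemma card_bulk u b : u \in V0 -> #|bulk u b| = #|outer (sigma u == b)|.
Proof.
move=> uV; rewrite -(card_imset _ (@ends_inj n)).
have -> : @ends n @: bulk u b = (fun w => [set u; w]) @: outer (sigma u == b).
  apply/finset.setP => D; apply/imsetP/imsetP.
    move=> [e + ->]; rewrite inE => /and3P[/edge_other[w wu ew]].
    rewrite (same_label_set2 _ ew) ew => uw wV; exists w => //.
    rewrite !inE; apply/andP; split.
      by apply: contra wV => wV; rewrite finset.subUset !finset.sub1set uV wV.
    by move: uw; case: (sigma u); case: (sigma w); case: b.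
  move=> [w]; rewrite !inE => /andP[wV sw] ->.
  have uw : u != w by apply: contra wV => /eqP <-.
  have c2 : #|[set u; w]| == 2%N by rewrite cards2 uw.
  exists (exist _ [set u; w] c2 : edge n) => //.
  have eE : ends (exist _ [set u; w] c2 : edge n) = [set u; w] by [].
  rewrite inE (same_label_set2 _ eE) eE !inE eqxx /=.
  rewrite finset.subUset !finset.sub1set uV /= wV andbT.
  by move: sw; case: (sigma u); case: (sigma w); case: b.
apply: card_in_imset => w w'; rewrite !inE => /andP[wV _] /andP[w'V _] /finset.setP.
move=> /(_ w); rewrite !inE eqxx orbT => /esym/orP[/eqP wu|/eqP //].
by move: wV; rewrite wu uV.
Qed.

Lemma card_inner u : (#|inner u| <= #|V0|)%N.
Proof.
rewrite -(card_imset _ (@ends_inj n)).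
apply: (@leq_trans #|(fun w => [set u; w]) @: V0|); last exact: leq_imset_card.
apply: subset_leq_card; apply/fintype.subsetP => _ /imsetP[e + ->].
rewrite inE => /andP[/edge_other[w wu ew] eV]; apply/imsetP; exists w => //.
by apply: (fintype.subsetP eV); rewrite ew !inE eqxx orbT.
Qed.

Lemma mass_profile u b : u \in V0 ->
  mass W (profile u b) = let p' := if b then p else q in
    binomial_term #|outer (sigma u == b)| k (p' * kS) (p' * kT).
Proof.
move=> uV; rewrite /= -card_bulk //.
by apply: (mass_binomial mu1) => // e; rewrite inE => /and3P[_ /eqP sb _];
  rewrite /edge_pmf sb.
Qed.

Lemma profile_local u b (x y : pair_graph n) :
  {in bulk u b, x =1 y} -> profile u b x = profile u b y.
Proof.
move=> xy; rewrite /profile; congr (_ && _).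
  congr (_ == _); apply: eq_card => e; rewrite [LHS]inE [RHS]inE.
  by case: (boolP (e \in bulk u b)) => //= eb; rewrite xy.
apply/eq_forallb => e; case: (boolP (e \in bulk u b)) => //= eb.
by rewrite xy.
Qed.

Lemma profile_depends u b :
  depends_on (bulk u b) (fun x => (profile u b x)%:R : R).
Proof. by move=> x y /profile_local ->. Qed.

Let bulk_profile u x := profile u true x && profile u false x.

Lemma bulk_profile_depends u :
  depends_on (bulk u true :|: bulk u false) (fun x => (bulk_profile u x)%:R : R).
Proof.
move=> x y xy; rewrite /bulk_profile.
rewrite (@profile_local u true x y); last by move=> e eb; apply: xy; rewrite inE eb.
by rewrite (@profile_local u false x y) // => e eb; apply: xy; rewrite inE eb orbT.
Qed.

Lemma mass_bulk_profile u : u \in V0 ->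
  mass W (bulk_profile u) = good_prob (sigma u).
Proof.
move=> uV; rewrite /good_prob.
rewrite (mass_indep mu1 (@profile_depends u true) (@profile_depends u false)).
  by rewrite !mass_profile //; case: (sigma u).
by move=> e; rewrite !inE => /and3P[_ /eqP -> _]; rewrite andbF.
Qed.

Lemma mass_good_le u : u \in V0 -> mass W (good u) <= good_prob (sigma u).
Proof.
move=> uV; rewrite -mass_bulk_profile //; apply: le_mass.
  exact: prod_pmf_ge0.
by move=> x /andP[].
Qed.

(** The inner edges are independent of the bulk edges, and u has at most #|V0|
    of them. *)
Lemma mass_good_ge u (h : R) : u \in V0 -> h <= 1 ->
  p * (1 - (1 - s) ^+ 2) <= h -> q * (1 - (1 - s) ^+ 2) <= h ->
  good_prob (sigma u) * (1 - #|V0|%:R * h) <= mass W (good u).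
Proof.
move=> uV h1 ph qh.
have h0 : 0 <= h.
  apply: le_trans ph; rewrite (_ : 1 - _ = s * (2 - s)); last by ring.
  case/andP: p01 => p0 _; case/andP: s01 => s0 s1.
  by rewrite !mulr_ge0 // subr_ge0 (le_trans s1) ?ler1n.
have h01 : 0 <= h <= 1 by rewrite h0.
rewrite (@mass_indep R _ _ _ mu1 _ (inner u) _ _ (@bulk_profile_depends u)).
- rewrite mass_bulk_profile //; apply: ler_wpM2l.
    by rewrite -mass_bulk_profile //; apply/mass_ge0/prod_pmf_ge0.
  rewrite (mass_all _ (fun e z => (e \in inner u) ==> (z == (false, false)))).
  rewrite (bigID (mem (inner u))) /= [X in _ <= _ * X]big1 ?mulr1; last first.
    by move=> e /negbTE eI; rewrite -[RHS](mu1 e); apply: eq_bigl => z; rewrite eI.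
  apply: (@le_trans _ _ (\prod_(e in inner u) (1 - h))).
    rewrite prodr_const; apply: le_trans (bernoulli_ineq _ h01).
    rewrite lerD2l lerN2; apply: ler_wpM2r => //.
    by rewrite ler_nat card_inner.
  apply: ler_prod => e eI; rewrite subr_ge0 h1 /= eI /= big_pred1_eq.
  rewrite /edge_pmf pair_pmfE eqxx lerD2l lerN2.
  by case: ifP.
- move=> x y xy; congr ((_ : bool)%:R); apply/eq_forallb => e.
  by case: (boolP (e \in inner u)) => //= eI; rewrite xy.
move=> e; rewrite !inE => /orP[] /and3P[_ _ /negbTE ->]; by rewrite andbF.
Qed.

(** The conditions on inner edges, which couple u and v, are dropped. *)
Lemma mass_good2 u v : u \in V0 -> v \in V0 -> u != v -> sigma u = sigma v ->
  mass W (fun x => good u x && good v x) <= good_prob (sigma u) ^+ 2.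
Proof.
move=> uV vV uv suv.
have -> : good_prob (sigma u) ^+ 2
   = mass W (fun x => bulk_profile u x && bulk_profile v x).
  rewrite (mass_indep mu1 (@bulk_profile_depends u) (@bulk_profile_depends v)).
    by rewrite !mass_bulk_profile // suv expr2.
  have dis e b b' : e \in bulk u b -> e \in bulk v b' -> false.
    rewrite !inE => /and3P[/edge_other[w wu ew] _ /negP eV] /and3P[ve _ _].
    case: eV; move: ve; rewrite ew !inE eq_sym (negbTE uv) /= => /eqP vw.
    by rewrite finset.subUset !finset.sub1set uV -vw.
  move=> e; rewrite finset.in_setU => eu; apply/negP; rewrite finset.in_setU => ev.
  by case/orP: eu => eu; case/orP: ev => ev; have := dis e _ _ eu ev.
apply: le_mass; first exact: prod_pmf_ge0.
by move=> x /andP[/andP[? _] /andP[? _]]; apply/andP.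
Qed.

Lemma few_good c (h t : R) : h <= 1 ->
  p * (1 - (1 - s) ^+ 2) <= h -> q * (1 - (1 - s) ^+ 2) <= h ->
  0 < t -> t <= #|[set u in V0 | sigma u == c]|%:R * good_prob c ->
  mass W (fun x => #|[set u in V0 | (sigma u == c) && good u x]|%:R < t / 2)
  <= 4 * (t^-1 + 2 * (#|V0|%:R * h)).
Proof.
move=> h1 ph qh t0; set C := [set u in V0 | sigma u == c] => tC.
have C0 : (0 < #|C|)%N.
  rewrite lt0n; apply/eqP => C0; move: (lt_le_trans t0 tC).
  by rewrite C0 mul0r ltxx.
have a0 : 0 < good_prob c.
  have := lt_le_trans t0 tC; rewrite pmulr_rgt0 // ltr0n; exact: C0.
have CP u : u \in C -> u \in V0 /\ sigma u = c.
  by rewrite inE => /andP[-> /eqP].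
have := @second_moment R _ _ W C good (good_prob c) (#|V0|%:R * h) 2^-1
  (prod_pmf_ge0 mu0) (prod_pmf_sum1 mu1) a0.
rewrite invr_gt0 ltr0n => /(_ isT C0) H.
apply: (@le_trans _ _ (4 * ((#|C|%:R * good_prob c)^-1 + 2 * (#|V0|%:R * h)))).
  have quarter (y : R) : 4 * y = y / 2^-1 ^+ 2 by field.
  rewrite quarter.
  apply: le_trans (H _ _).
  - apply: le_mass; first exact: prod_pmf_ge0.
    move=> x; rewrite (_ : [set u in V0 | _] = [set u in C | good u x]).
      move=> lt; rewrite ltr0_norm; last by lra.
      by lra.
    by apply/finset.setP => u; rewrite !inE andbA.
  - move=> u /CP[uV <-]; rewrite mass_good_le // andbT.
    exact: mass_good_ge.
  by move=> u v /CP[uV uc] /CP[vV vc] uv; rewrite -uc mass_good2 // uc vc.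
rewrite ler_pM2l // lerD2r lef_pV2 // posrE.
exact: lt_le_trans tC.
Qed.

(** Inner edges are in the zero state, which is neither a hit nor a clash, so
    the counts over all edges at u are the counts over its bulk edges. *)
Lemma good_swappable u v x : u \in V0 -> v \in V0 ->
  ~~ sigma u -> sigma v -> good u x -> good v x ->
  swappable S T sigma x u v.
Proof.
move=> uV vV su sv.
have bal w : good w x -> balanced S T sigma x w.
  case/andP => /andP[/andP[/eqP c1 /forallP T1] /andP[/eqP c0 /forallP T0]].
  move=> /forallP I; have I00 e : e \in inner w -> x e = (false, false).
    by move=> eI; have := I e; rewrite eI /= => /eqP.
  have cE b : #|[set e | [&& w \in ends e, same_label sigma e == b & S (x e)]]|
     = #|[set e in bulk w b | S (x e)]|.
    apply: eq_card => e; rewrite !inE.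
    case: (boolP (e \in inner w)) => eI.
      by rewrite I00 // (negbTE S00) !andbF.
    by move: eI; rewrite inE; case: (w \in _) => //= ->; rewrite andbT.
  apply/andP; split; last first.
    apply/forallP => e; apply/implyP => we.
    case: (boolP (e \in inner w)) => eI; first by rewrite I00.
    have := T1 e; have := T0 e; move: eI; rewrite !inE we /= => ->.
    by case: (same_label _ _).
  have := cE true; have := cE false; rewrite c1 c0 => e0 e1.
  apply/eqP; transitivity k; [rewrite -e1|rewrite -e0];
    by apply: eq_card => e; rewrite !inE; case: (same_label _ _).
move=> gu gv; apply/and5P; split=> //; try exact: bal.
apply/forallP => e; apply/implyP => /andP[ue ve].
have /andP[_ /forallP/(_ e)] := gu.
rewrite inE ue /=; have [w wu ew] := edge_other ue.
have -> : ends e \subset V0.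
  move: ve; rewrite ew !inE => /orP[/eqP vu|/eqP <-].
    by move: sv; rewrite vu (negbTE su).
  by rewrite finset.subUset !finset.sub1set uV.
by move=> /= /eqP ->.
Qed.

End GoodVertices.

(** * Lower bounds for binomial probabilities *)

Section BinomialEstimates.
Context {R : realType}.
Implicit Types (a b x y d : R) (k M : nat).

(** A weak form of Stirling's formula.  The induction step is
    (k / (k + 1)) ^ (k + 1) <= exp (- 1). *)
Lemma fact_mul_expR_le k :
  k`!%:R * expR (k%:R - 1) <= k%:R ^+ k * (k%:R + 1) :> R.
Proof.
case: k => [|k].
  by rewrite fact0 expr0 !mul1r !mulr0n !add0r expR_le1; lra.
suff H : (k.+1)`!%:R * expR (k.+1%:R - 1) <= k.+1%:R ^+ k.+2 :> R.
  apply: (le_trans H); rewrite exprSr; apply: ler_wpM2l; first exact: exprn_ge0.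
  by rewrite lerDl.
elim: k => [|k IH].
  by rewrite factS fact0 muln1 subrr expR0 mulr1 expr1n.
rewrite factS natrM.
have -> : k.+2%:R - 1 = (k.+1%:R - 1) + 1 :> R by rewrite -[k.+2%:R]natr1; ring.
rewrite expRD mulrA -(mulrA k.+2%:R) -mulrA.
apply: (@le_trans _ _ (k.+2%:R * (k.+1%:R ^+ k.+2 * expR 1))).
  by rewrite -mulrA; apply: ler_wpM2l => //; rewrite mulrA;
    apply: ler_wpM2r => //; exact: expR_ge0.
rewrite [leRHS]exprS; apply: ler_wpM2l => //.
have k2 : 0 < k.+2%:R :> R by [].
have H : k.+1%:R / k.+2%:R <= expR (- k.+2%:R^-1) :> R.
  apply: le_trans (expR_ge1Dx _); rewrite -[k.+2%:R]natr1.
  have : 0 < k.+1%:R :> R by [].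
  move: (k.+1%:R : R) => z z0; rewrite le_eqVlt; apply/orP; left; apply/eqP.
  by field; rewrite gt_eqF //; lra.
have : (k.+1%:R / k.+2%:R) ^+ k.+2 <= expR (- 1) :> R.
  apply: (@le_trans _ _ (expR (- k.+2%:R^-1) ^+ k.+2)).
    by apply: lerXn2r => //; rewrite nnegrE ?divr_ge0 // expR_ge0.
  by rewrite -expRM_natl mulrN mulfV // pnatr_eq0.
rewrite expr_div_n ler_pdivrMr ?exprn_gt0 // => H2.
apply: (@le_trans _ _ (expR (- 1) * k.+2%:R ^+ k.+2 * expR 1)).
  by apply: ler_wpM2r => //; exact: expR_ge0.
by rewrite mulrAC -expRD addNr expR0 mul1r.
Qed.

(** The largest term of the exponential series of y, at k = trunc y, is within
    a linear factor of the whole sum. *)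
Lemma expR_le_pow_fact y k : 0 <= y -> k = Num.trunc y ->
  expR (y - 2) / (y + 1) <= y ^+ k / k`!%:R.
Proof.
move=> y0 ->; set j := Num.trunc y.
have /andP[jy yj] := truncn_itv y0; rewrite -/j in jy yj.
have f0 : 0 < j`!%:R :> R by rewrite ltr0n fact_gt0.
rewrite ler_pdivrMr; last by lra.
rewrite mulrAC ler_pdivlMr // mulrC.
apply: (@le_trans _ _ (j`!%:R * expR (j%:R - 1))).
  apply: ler_wpM2l; first exact: ltW.
  by rewrite ler_expR; move: yj; rewrite -natr1; lra.
apply: (le_trans (fact_mul_expR_le j)).
apply: ler_pM; rewrite ?lerD2r ?exprn_ge0 ?addr_ge0 //.
by apply: lerXn2r; rewrite ?nnegrE.
Qed.

Lemma bin_ge M k : ((M - k) ^ k <= 'C(M, k) * k`!)%N.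
Proof.
rewrite bin_ffact ffact_prod -[X in (_ ^ X)%N]card_ord -prod_nat_const.
by apply: leq_prod => i _; apply: leq_sub2l; apply: ltnW.
Qed.

Lemma onem_ge_expR x d : 0 < d -> 0 <= x -> x * (1 + d) <= d ->
  expR (- ((1 + d) * x)) <= 1 - x.
Proof.
move=> d0 x0 xd.
have x1 : x < 1 by nra.
have y0 : 0 < 1 - x by lra.
rewrite expRN -[leRHS]invrK lef_pV2 ?posrE ?expR_gt0 ?invr_gt0 //.
apply: le_trans (expR_ge1Dx _).
rewrite -[leLHS]mul1r ler_pdivrMr //; nra.
Qed.

Lemma binomial_term_ge M k a b d : 0 <= a -> 0 <= b -> 0 < d ->
  (a + b) * (1 + d) <= d ->
  ((M - k)%:R * a) ^+ k / k`!%:R * expR (- ((1 + d) * ((a + b) * M%:R)))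
  <= binomial_term M k a b.
Proof.
move=> a0 b0 d0 abd; have ab0 : 0 <= a + b by rewrite addr_ge0.
have E := onem_ge_expR d0 ab0 abd.
have q0 : 0 <= 1 - (a + b) by apply: le_trans E; exact: expR_ge0.
have q1 : 1 - (a + b) <= 1 by lra.
have f0 : 0 < k`!%:R :> R by rewrite ltr0n fact_gt0.
have -> : binomial_term M k a b
   = 'C(M, k)%:R * a ^+ k * (1 - (a + b)) ^+ (M - k).
  by rewrite /binomial_term -[LHS]mulr_natl mulrA opprD addrA.
apply: ler_pM.
- by rewrite divr_ge0 // exprn_ge0 // mulr_ge0.
- exact: expR_ge0.
- rewrite exprMn mulrAC; apply: ler_wpM2r; first exact: exprn_ge0.
  by rewrite ler_pdivrMr // -natrX -natrM ler_nat bin_ge.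
apply: (@le_trans _ _ ((1 - (a + b)) ^+ M)).
  rewrite (_ : - _ = M%:R * - ((1 + d) * (a + b))); last by ring.
  by rewrite expRM_natl; apply: lerXn2r => //; rewrite nnegrE // expR_ge0.
(* For M < k the exponent M - k is 0. *)
have [kM|Mk] := leqP k M; last first.
  by rewrite (eqP (ltnW Mk)) expr0 exprn_ile1.
by rewrite -[X in _ ^+ X <= _](subnK kM) exprD ler_piMr ?exprn_ge0 ?exprn_ile1.
Qed.

(** Two independent binomial variables, with means close to y1 and y2, both
    take the value trunc y, where y ^ 2 = y1 y2, with probability about
    exp (2 y - y1 - y2) = exp (- (sqrt y1 - sqrt y2) ^ 2).  The rates b1 and b2
    of clashes add to y1 + y2 in w, and the factor 1 + d pays for replacing
    1 - x by an exponential. *)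
Lemma binomial_pair_ge M1 M2 k a1 b1 a2 b2 d y w :
  0 <= a1 -> 0 <= b1 -> 0 <= a2 -> 0 <= b2 -> 0 < d ->
  (a1 + b1) * (1 + d) <= d -> (a2 + b2) * (1 + d) <= d ->
  0 <= y -> k = Num.trunc y ->
  y ^+ 2 <= ((M1 - k)%:R * a1) * ((M2 - k)%:R * a2) ->
  (a1 + b1) * M1%:R + (a2 + b2) * M2%:R <= w ->
  expR (2 * y - 4 - (1 + d) * w) / (y + 1) ^+ 2
  <= binomial_term M1 k a1 b1 * binomial_term M2 k a2 b2.
Proof.
move=> a10 b10 a20 b20 d0 ab1 ab2 y0 kE yM wM.
have H1 := binomial_term_ge M1 k a10 b10 d0 ab1.
have H2 := binomial_term_ge M2 k a20 b20 d0 ab2.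
have f0 : 0 < k`!%:R :> R by rewrite ltr0n fact_gt0.
apply: le_trans (ler_pM _ _ H1 H2); last 2 first.
- by rewrite mulr_ge0 ?expR_ge0 // divr_ge0 // exprn_ge0 // mulr_ge0.
- by rewrite mulr_ge0 ?expR_ge0 // divr_ge0 // exprn_ge0 // mulr_ge0.
set A := (_ * a1) in yM *; set B := (_ * a2) in yM *.
set e1 := expR (- ((1 + d) * ((a1 + b1) * M1%:R))).
set e2 := expR (- ((1 + d) * ((a2 + b2) * M2%:R))).
have -> : A ^+ k / k`!%:R * e1 * (B ^+ k / k`!%:R * e2)
   = (A * B) ^+ k / k`!%:R ^+ 2 * (e1 * e2).
  rewrite [(A * B) ^+ k]exprMn expr2 invfM.
  by move: (A ^+ k) (B ^+ k) (k`!%:R^-1) => ? ? ?; ring.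
have -> : expR (2 * y - 4 - (1 + d) * w) / (y + 1) ^+ 2
   = (expR (y - 2) / (y + 1)) ^+ 2 * expR (- ((1 + d) * w)).
  rewrite expr_div_n -expRM_natl mulrAC -expRD; congr (expR _ / _); ring.
apply: ler_pM; try exact: expR_ge0.
- exact: sqr_ge0.
- apply: (@le_trans _ _ ((y ^+ k / k`!%:R) ^+ 2)).
    apply: lerXn2r; rewrite ?nnegrE.
    + by rewrite divr_ge0 ?expR_ge0 // addr_ge0.
    + by rewrite divr_ge0 // exprn_ge0.
    + exact: expR_le_pow_fact.
  rewrite expr_div_n -exprM mulnC exprM; apply: ler_wpM2r.
    by rewrite invr_ge0 exprn_ge0.
  apply: lerXn2r => //; rewrite nnegrE ?sqr_ge0 //.
  exact: le_trans (sqr_ge0 y) yM.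
rewrite /e1 /e2 -expRD ler_expR -opprD lerN2 -mulrDr ler_wpM2l //.
by lra.
Qed.

End BinomialEstimates.

(** * Exchange schemes *)

Section ExchangeScheme.
Context {R : realType}.

(** A kind of exchange, with the states that count as hits and as clashes.  The
    rates are relative to the edge probability of the parent graph. *)
Record exchange_scheme (s : R) := ExchangeScheme {
  hit : pred (bool * bool);
  clash : pred (bool * bool);
  hit_rate : R;
  clash_rate : R;
  new_state : bool * bool -> bool * bool -> bool * bool;
  hit00 : ~~ hit (false, false);
  clash00 : ~~ clash (false, false);
  hit_clash : forall z, hit z -> ~~ clash z;
  hit_mass : forall p, \sum_(z | hit z) pair_pmf p s z = p * hit_rate;
  clash_mass : forall p, \sum_(z | clash z) pair_pmf p s z = p * clash_rate;
  new_state_id : forall z, new_state z z = z;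
  scheme_exchange : forall p q, 0 <= p <= 1 -> 0 <= q <= 1 ->
    0 < 1 - p * (1 - (1 - s) ^+ 2) -> 0 < 1 - q * (1 - (1 - s) ^+ 2) ->
    local_exchange hit clash new_state (fun c => pair_pmf (if c then p else q) s);
  scheme_move : forall n, exists mv : 'I_n * 'I_n -> config n -> config n,
    hidden_move new_state mv }.

(** The probability that a vertex is good is n to the power minus this
    exponent, up to lower order factors. *)
Definition scheme_exponent (s a b : R) (X : exchange_scheme s) : R :=
  (hit_rate X + clash_rate X) * ((a + b) / 2)
  - hit_rate X * (Num.sqrt a * Num.sqrt b).

Lemma union_scheme (s : R) : 0 <= s <= 1 -> exists X : exchange_scheme s,
  hit_rate X = 1 - (1 - s) ^+ 2 /\ clash_rate X = 0.
Proof.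
move=> s01; have mv n := ex_intro (hidden_move keep_states) _ (@relabelled_move n).
pose hit z := z != (false, false) :> bool * bool.
have h p : \sum_(z | hit z) pair_pmf p s z = p * (1 - (1 - s) ^+ 2).
  have := pair_pmf_sum1 p s; rewrite (bigD1 (false, false)) //= pair_pmfE /=.
  by rewrite /hit; lra.
exists (@ExchangeScheme s hit pred0 (1 - (1 - s) ^+ 2) 0 keep_states isT isT
  (fun _ _ => isT) h (fun p => etrans (big_pred0_eq _ _ _ _) (esym (mulr0 p)))
  (fun _ => erefl) (fun p q p01 q01 => union_exchange p01 q01 s01) mv).
by [].
Qed.

Lemma intersection_scheme (s : R) : 0 <= s <= 1 -> exists X : exchange_scheme s,
  hit_rate X = s * (1 - s) /\ clash_rate X = s ^+ 2.
Proof.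
move=> s01; have mv n := ex_intro (hidden_move swap_second) _ (@realigned_move n).
have sing (z0 : bool * bool) p :
    \sum_(z | z == z0) pair_pmf p s z = pair_pmf p s z0 by rewrite big_pred1_eq.
have h p : \sum_(z | z == (true, false)) pair_pmf p s z = p * (s * (1 - s)).
  by rewrite sing pair_pmfE /= !expr1.
have c p : \sum_(z | z == (true, true)) pair_pmf p s z = p * s ^+ 2.
  by rewrite sing pair_pmfE /= mulr1.
have hc z : z == (true, false) -> z != (true, true) :> bool * bool by move=> /eqP ->.
have id z : swap_second z z = z by case: z.
by exists (@ExchangeScheme s (fun z => z == (true, false))
  (fun z => z == (true, true)) _ _ swap_second isT isT hc h c id
  (fun p q p01 q01 => intersection_exchange p01 q01 s01) mv).
Qed.

Lemma hit_rate_ge0 s (X : exchange_scheme s) : 0 <= s <= 1 -> 0 <= hit_rate X.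
Proof.
move=> s01; rewrite -[hit_rate X]mul1r -hit_mass.
by apply: sumr_ge0 => z _; apply: pair_pmf_ge0; rewrite ?ler01 ?lexx.
Qed.

Lemma clash_rate_ge0 s (X : exchange_scheme s) : 0 <= s <= 1 -> 0 <= clash_rate X.
Proof.
move=> s01; rewrite -[clash_rate X]mul1r -clash_mass.
by apply: sumr_ge0 => z _; apply: pair_pmf_ge0; rewrite ?ler01 ?lexx.
Qed.

(** Inside V0 a rough balance of the labels suffices.  Outside V0 the class
    sizes enter the exponent, so the tolerance lam must be adjustable. *)
Definition typical_labels n (V0 : {set 'I_n}) (lam : R) (sigma : labels n) :=
  [forall c, (`| #|[set i in V0 | sigma i == c]|%:R - #|V0|%:R * 2^-1 |
               < 2^-1 * (#|V0|%:R * 2^-1) :> R)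
          && (`| #|[set i in ~: V0 | sigma i == c]|%:R - #|~: V0|%:R * 2^-1 |
               < lam * (#|~: V0|%:R * 2^-1))].

Lemma atypical_le n (V0 : {set 'I_n}) (lam : R) :
  0 < lam -> (0 < #|V0|)%N -> (0 < #|~: V0|)%N ->
  mass (@labels_pmf R n) (fun sigma => ~~ typical_labels V0 lam sigma)
  <= 16 / #|V0|%:R + 4 / #|~: V0|%:R / lam ^+ 2.
Proof.
move=> lam0 V0gt VCgt; have w0 := @labels_pmf_ge0 R n.
pose bad (B : {set 'I_n}) (d : R) (c : bool) (sigma : labels n) :=
  d * (#|B|%:R * 2^-1) <= `| #|[set i in B | sigma i == c]|%:R - #|B|%:R * 2^-1 |.
have half0 : 0 < 2^-1 :> R by rewrite invr_gt0.
apply: (@le_trans _ _ (mass (@labels_pmf R n) (fun sigma =>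
   (bad V0 2^-1 true sigma || bad (~: V0) lam true sigma)
   || (bad V0 2^-1 false sigma || bad (~: V0) lam false sigma)))).
  apply: le_mass => // sigma; rewrite negb_forall => /existsP[c].
  rewrite negb_and -!leNgt => /orP H; rewrite /bad; apply/orP.
  by case: c H => [[]->|[]->]; rewrite ?orbT; [left|left|right|right].
have B1 c := @label_concentration R n V0 c 2^-1 half0 V0gt.
have B2 c := @label_concentration R n (~: V0) c lam lam0 VCgt.
apply: (le_trans (mass_or _ _ w0)).
apply: (le_trans (lerD (mass_or _ _ w0) (mass_or _ _ w0))).
apply: (le_trans (lerD (lerD (B1 true) (B2 true)) (lerD (B1 false) (B2 false)))).
rewrite le_eqVlt; apply/orP; left; apply/eqP; field.
by rewrite gt_eqF // !pnatr_eq0 -!lt0n V0gt VCgt.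
Qed.

(** Unless the labels are atypical or one class has fewer than t / 2 good
    vertices in V0, at least (t / 2) ^ 2 exchanges are available. *)
Lemma csbm_prob_recovery_le n (p q s : R) (X : exchange_scheme s) (V0 : {set 'I_n})
    (est : graph n -> graph n -> labels n) (k : nat) (h t : R)
    (typ : pred (labels n)) :
  0 <= p <= 1 -> 0 <= q <= 1 -> 0 <= s <= 1 -> h < 1 ->
  p * (1 - (1 - s) ^+ 2) <= h -> q * (1 - (1 - s) ^+ 2) <= h -> 0 < t ->
  (forall sigma, typ sigma -> forall c,
     t <= #|[set u in V0 | sigma u == c]|%:R
          * good_prob sigma V0 p q (hit_rate X) (clash_rate X) k c) ->
  csbm_prob p q s (fun sigma G1 G2 => overlap (est G1 G2) sigma == 1 :> R)
  <= mass (@labels_pmf R n) (fun sigma => ~~ typ sigma)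
     + 8 * (t^-1 + 2 * (#|V0|%:R * h)) + 8 / t ^+ 2.
Proof.
move=> p01 q01 s01 h1 ph qh t0 typP; rewrite csbm_prob_mass.
have [mv mvP] := scheme_move X n.
have exch : local_exchange (hit X) (clash X) (new_state X)
    (fun c => pair_pmf (if c then p else q) s).
  by apply: scheme_exchange => //; lra.
pose gd (sigma : labels n) (c : bool) (x : pair_graph n) :=
  #|[set u in V0 | (sigma u == c) && good sigma V0 (hit X) (clash X) k u x]|.
pose few (sigma : labels n) (c : bool) (x : pair_graph n) := (gd sigma c x)%:R < t / 2.
pose bad (sigma : labels n) (x : pair_graph n) := ~~ typ sigma || (typ sigma && (few sigma true x || few sigma false x)).
(* Every choice of a good vertex in each class is an admissible exchange. *)
pose K : R := (t / 2) ^+ 2.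
have K0 : 0 < K by rewrite exprn_gt0 // divr_gt0.
have w0 (w : config n) : 0 <= config_pmf p q s w by exact: config_pmf_ge0.
pose A (w : config n) := overlap (est (obs w).1 (obs w).2) w.1.1 == 1 :> R.
pose ok (w : config n) (j : 'I_n * 'I_n) :=
  swappable (hit X) (clash X) w.1.1 w.1.2 j.1 j.2.
apply: (@le_trans _ _ (mass (config_pmf p q s) (fun w =>
    bad w.1.1 w.1.2 || (A w && (K <= #|[set j | ok w j]|%:R))))).
  apply: le_mass => // w; rewrite -/(A w) => ->.
  case: (boolP (bad _ _)) => //=; rewrite negb_or negbK => /andP[tw].
  rewrite tw /= negb_or -!leNgt => /andP[gT gF].
  apply: (@le_trans _ _ ((gd w.1.1 false w.1.2)%:R * (gd w.1.1 true w.1.2)%:R)).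
    by rewrite /K expr2; apply: ler_pM => //; rewrite ltW // divr_gt0.
  rewrite -natrM ler_nat -cardsX; apply: subset_leq_card.
  apply/fintype.subsetP => -[u v]; rewrite !inE /=.
  move=> /andP[/and3P[uV /eqP su gu] /and3P[vV /eqP sv gv]].
  apply: (good_swappable (hit00 X) (clash00 X) uV vV) => //; rewrite ?su ?sv //.
  - exact: gu.
  - exact: gv.
apply: (le_trans (mass_or _ _ w0)); apply: lerD; last first.
  have -> : 8 / t ^+ 2 = 2 / K by rewrite /K; field; rewrite gt_eqF.
  exact: (recovery_le est p01 q01 s01 (new_state_id X) exch mvP K0).
rewrite (mass_config p q s bad).
pose W (sigma : labels n) := prod_pmf (edge_pmf p q s sigma).
set eps := 8 * _.
have eps0 : 0 <= eps.
  have h0 : 0 <= h.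
    apply: le_trans ph; rewrite (_ : 1 - _ = s * (2 - s)); last by ring.
    case/andP: p01 => p0 _; case/andP: s01 => s0 s1.
    by rewrite !mulr_ge0 // subr_ge0 (le_trans s1) ?ler1n.
  by rewrite /eps !mulr_ge0 // addr_ge0 ?mulr_ge0 // invr_ge0 ltW.
have W0 sigma x : 0 <= W sigma x.
  by apply: prod_pmf_ge0 => e z; exact: edge_pmf_ge0.
have W1 sigma : \sum_x W sigma x = 1.
  by apply: prod_pmf_sum1 => e; exact: edge_pmf_sum1.
have -> : mass (@labels_pmf R n) (fun sigma => ~~ typ sigma) + eps
    = \sum_sigma labels_pmf sigma * ((~~ typ sigma)%:R + eps).
  under eq_bigr do rewrite mulrDr.
  by rewrite big_split /= -massE -mulr_suml labels_pmf_sum1 mul1r.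
apply: ler_sum => sigma _; apply: ler_wpM2l; first exact: labels_pmf_ge0.
case: (boolP (typ sigma)) => tw /=; last first.
  rewrite -(W1 sigma) ler_wpDr // /mass.
  by rewrite [leRHS](bigID (bad sigma)) /= lerDl sumr_ge0.
rewrite add0r; apply: (@le_trans _ _ (mass (W sigma)
    (fun x => few sigma true x || few sigma false x))).
  by apply: le_mass => [|x /orP[/negP/(_ tw)|/andP[]]] //; exact: W0.
apply: (le_trans (mass_or _ _ (W0 sigma))).
have F c : mass (W sigma) (few sigma c) <= 4 * (t^-1 + 2 * (#|V0|%:R * h)).
  apply: (few_good (hit_clash (e := X)) p01 q01 s01 (hit_mass X) (clash_mass X)
     (ltW h1) ph qh t0 (typP _ tw c)).
apply: (le_trans (lerD (F true) (F false))).
by rewrite /eps; lra.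
Qed.

End ExchangeScheme.

(** * Asymptotics *)

Section Asymptotics.
Context {R : realType}.

(** The strict inequality leaves room for class sizes that deviate from n / 2 by
    a relative error d. *)
Lemma exponent_slack (u v : R) : 0 <= u -> 0 <= v -> u - v < 1 ->
  exists d rho, [/\ 0 < d, d <= 2^-1, 0 < rho &
                    (1 + d) ^+ 2 * u - (1 - d) * v <= 1 - rho].
Proof.
move=> u0 v0 uv; pose g := 1 - u + v; have g0 : 0 < g by rewrite /g; lra.
(* For d <= 1 the exponent grows by at most d (3 u + v); the term g in D only
   ensures d <= 1 / 2. *)
pose D := 3 * u + v + 1 + g; have D0 : 0 < D by rewrite /D; lra.
exists (g / (2 * D)), (g / 2).
have d0 : 0 < g / (2 * D) by rewrite divr_gt0 // mulr_gt0.
have dD : g / (2 * D) * D = g / 2 by field; rewrite gt_eqF.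
have d1 : g / (2 * D) <= 2^-1.
  rewrite ler_pdivrMr ?mulr_gt0 // mulrA mulVf ?pnatr_eq0 // mul1r /D; lra.
move: dD d0 d1; move: (g / (2 * D)) => d dD d0 d1; split => //; first lra.
have : d ^+ 2 * u <= d * u 
  by rewrite expr2 -mulrA; apply: ler_wpM2l; [exact: ltW|rewrite ler_piMl //; lra].
have : 0 <= d * (1 + g) by rewrite mulr_ge0 // ltW //; lra.
have : d * D = d * (3 * u + v) + d * (1 + g) by rewrite /D; ring.
rewrite dD /g; nra.
Qed.

(** Outside V0 both classes have about n / 2 vertices, so the expected number of
    hits is about a kS L / 2 towards one class and b kS L / 2 towards the other;
    y is their geometric mean, shrunk by 1 - d to absorb the fluctuations of
    the class sizes. *)
Lemma good_prob_ge n (sigma : labels n) (V0 : {set 'I_n}) (k : nat)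
    (a b kS kT d L y : R) :
  (0 < n)%N -> 0 <= a -> 0 <= b -> 0 <= kS -> 0 <= kT -> 0 <= L ->
  0 < d -> d <= 2^-1 ->
  (kS + kT) * (a + b) * L * (1 + d) <= d * n%:R ->
  y = (1 - d) * (kS * (Num.sqrt a * Num.sqrt b)) * L / 2 -> k = Num.trunc y ->
  #|V0|%:R + 2 * y <= d / 2 * n%:R ->
  typical_labels V0 (d / 2) sigma -> forall c,
  expR (2 * y - 4 - (1 + d) ^+ 2 * ((kS + kT) * ((a + b) / 2)) * L) / (y + 1) ^+ 2
  <= good_prob sigma V0 (a * L / n%:R) (b * L / n%:R) kS kT k c.
Proof.
move=> n0 a0 b0 kS0 kT0 L0 d0 d2 cN yE kE cM /forallP typ c.
set N : R := n%:R in cN cM *.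
have N0 : 0 < N by rewrite /N ltr0n.
have ab0 : 0 <= Num.sqrt a * Num.sqrt b by rewrite mulr_ge0 ?sqrtr_ge0.
have y0 : 0 <= y by rewrite yE divr_ge0 // !mulr_ge0 ?sqrtr_ge0 //; lra.
have ky : k%:R <= y by rewrite kE truncn_le.
have VC : #|~: V0|%:R = N - #|V0|%:R :> R.
  have <- : (#|V0| + #|~: V0|)%:R = N by rewrite cardsC card_ord.
  by rewrite natrD addrAC subrr add0r.
have M_bounds c' : let M := #|outer sigma V0 c'| in
    (1 - d) * N / 2 <= (M - k)%:R /\ M%:R <= (1 + d) * N / 2.
  have /andP[_] := typ c'; rewrite -/(outer sigma V0 c') VC.
  set M := #|outer sigma V0 c'| => /= H.
  have /andP[lo hi] : (1 - d / 2) * ((N - #|V0|%:R) / 2) <= M%:R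
                      <= (1 + d / 2) * ((N - #|V0|%:R) / 2).
    by move: H; rewrite ltr_norml => /andP[? ?]; apply/andP; split; lra.
  have m0 : 0 <= #|V0|%:R :> R by [].
  split; last by nra.
  have lo2 : (1 - d) * N / 2 <= M%:R - k%:R by nra.
  apply: (le_trans lo2); have [kM|Mk] := leqP k M; first by rewrite natrB.
  by rewrite (le_trans _ (ler0n _ _)) // subr_le0 ler_nat ltnW.
have rate r : N * (r * L / N) = r * L by field; rewrite gt_eqF.
have rate0 r : 0 <= r -> 0 <= r * L / N by move=> r0; rewrite divr_ge0 ?mulr_ge0 // ltW.
have small r : 0 <= r -> r <= a + b ->
    (r * L / N * kS + r * L / N * kT) * (1 + d) <= d.
  move=> r0 rab; rewrite -mulrDr (_ : _ * _ = (kS + kT) * r * L * (1 + d) / N).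
    rewrite ler_pdivrMr //; apply: le_trans cN.
    apply: ler_wpM2r; first lra.
    by apply: ler_wpM2r => //; apply: ler_wpM2l => //; rewrite addr_ge0.
  by field; rewrite gt_eqF.
have [lo1 hi1] := M_bounds c; have [lo2 hi2] := M_bounds (~~ c).
rewrite /good_prob.
rewrite (_ : 2 * y - 4 - _ = 2 * y - 4 - (1 + d) * ((1 + d)
   * ((kS + kT) * ((a + b) / 2)) * L)); last by ring.
apply: binomial_pair_ge => //.
- by rewrite mulr_ge0 ?rate0.
- by rewrite mulr_ge0 ?rate0.
- by rewrite mulr_ge0 ?rate0.
- by rewrite mulr_ge0 ?rate0.
- by apply: small => //; rewrite lerDl.
- by apply: small => //; rewrite lerDr.
- have lower r M : 0 <= r -> (1 - d) * N / 2 <= M ->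
      (1 - d) * (r * L) / 2 * kS <= M * (r * L / N * kS).
    move=> r0 lo; rewrite mulrA; apply: ler_wpM2r => //.
    rewrite (_ : _ / 2 = (1 - d) * N / 2 * (r * L / N)).
      by apply: ler_wpM2r; rewrite ?rate0.
    by field; rewrite gt_eqF.
  have -> : y ^+ 2 = ((1 - d) * (a * L) / 2 * kS) * ((1 - d) * (b * L) / 2 * kS).
    by rewrite -(sqr_sqrtr a0) -(sqr_sqrtr b0) yE; field.
  apply: ler_pM; try exact: lower.
  + by rewrite !mulr_ge0 ?invr_ge0 //; lra.
  + by rewrite !mulr_ge0 ?invr_ge0 //; lra.
have upper r M : 0 <= r -> M <= (1 + d) * N / 2 ->
    (r * L / N * kS + r * L / N * kT) * M <= (kS + kT) * (r * L) * (1 + d) / 2.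
  move=> r0 hi; rewrite -mulrDr.
  rewrite [leRHS](_ : _ = (r * L / N) * (kS + kT) * ((1 + d) * N / 2)).
    by apply: ler_wpM2l; rewrite // mulr_ge0 ?rate0 // addr_ge0.
  by field; rewrite gt_eqF.
apply: (le_trans (lerD (upper _ _ a0 hi1) (upper _ _ b0 hi2))).
by rewrite le_eqVlt; apply/orP; left; apply/eqP; field.
Qed.

Lemma exists_set_card n m : (m <= n)%N -> exists V : {set 'I_n}, #|V| = m.
Proof.
move=> mn; exists [set i in take m (enum 'I_n)].
rewrite cardsE; have /card_uniqP -> := take_uniq m (enum_uniq 'I_n).
by rewrite size_take size_enum_ord; case: ltngtP mn.
Qed.

Lemma linear_scale_le (d L N x : R) :
  0 < d -> 1 <= L -> L ^+ 3 <= 6 * N -> x <= d * L -> x * L <= 6 * d * N.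
Proof.
move=> d0 L1 N3 xL; have L0 : 0 <= L by apply: le_trans L1.
apply: (@le_trans _ _ (d * L ^+ 3)).
  apply: (@le_trans _ _ (d * L * L)); first exact: ler_wpM2r.
  rewrite -mulrA; apply: ler_wpM2l; first exact: ltW.
  by rewrite exprS expr2; apply: ler_wpM2l => //; rewrite ler_peMr.
by rewrite (mulrC 6) -mulrA; apply: ler_wpM2l => //; exact: ltW.
Qed.

Lemma window_size (d L N m : R) :
  0 < d -> 12 <= L -> 4 <= d * L -> L ^+ 3 <= 6 * N ->
  m <= N / L ^+ 2 -> N / L ^+ 2 < m + 1 ->
  N / L ^+ 2 / 2 <= m /\ m <= d / 4 * N.
Proof.
move=> d0 L12 dL N3 m_le m_gt.
have L1 : 1 <= L by apply: le_trans L12; rewrite ler1n.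
have L0 : 0 < L by apply: lt_le_trans L1.
have L2 : 0 < L ^+ 2 by rewrite exprn_gt0.
have N2 : 2 * L ^+ 2 <= N.
  have : 12 * L ^+ 2 <= L ^+ 3 by rewrite [leRHS]exprS; apply: ler_wpM2r; rewrite // ltW.
  lra.
have q2 : 2 <= N / L ^+ 2 by rewrite ler_pdivlMr.
split; first by lra.
apply: (le_trans m_le); rewrite ler_pdivrMr //.
have dL2 : 4 <= d * L ^+ 2.
  apply: (le_trans dL); apply: ler_wpM2l; first exact: ltW.
  by rewrite expr2 ler_peMr // ltW.
have N0 : 0 <= N by apply: le_trans N2; rewrite mulr_ge0 // ltW.
have := ler_wpM2r N0 dL2; lra.
Qed.

(** The right-hand side has the size of V0 times the probability of being good.
    The factor exp (rho L) gained from the slack rho is at least of order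
    L ^ 5 and beats the polynomial losses, which are of order L ^ 4. *)
Lemma expected_good_ge (rho V L N y w F : R) :
  F = 5`!%:R -> 0 < rho -> 0 <= V -> 0 < L -> N = expR L -> 0 <= y -> y + 1 <= (V + 1) * L ->
  - ((1 - rho) * L) <= 2 * y - w ->
  rho ^+ 5 * expR (- 4) / (8 * F * (V + 1) ^+ 2) * L
  <= N / (8 * L ^+ 2) * (expR (2 * y - 4 - w) / (y + 1) ^+ 2).
Proof.
move=> FE rho0 V0 L0 NE y0 yV slack.
have F0 : 0 < F by rewrite FE ltr0n fact_gt0.
have V1 : 0 < V + 1 by apply: ltr_wpDl.
have N0 : 0 < N by rewrite NE expR_gt0.
have L2 : 0 < L ^+ 2 by rewrite exprn_gt0.
have E1 : expR (- ((1 - rho) * L) - 4) <= expR (2 * y - 4 - w).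
  by rewrite ler_expR; lra.
have E2 : rho ^+ 5 * L ^+ 5 / F <= expR (rho * L).
  have := @expR_ge1Dxn _ (rho * L) 4 (mulr_ge0 (ltW rho0) (ltW L0)).
  by rewrite -FE exprMn; apply: le_trans; rewrite lerDr.
have E3 : (y + 1) ^+ 2 <= (V + 1) ^+ 2 * L ^+ 2.
  rewrite -exprMn; apply: lerXn2r; rewrite ?nnegrE //.
    by rewrite addr_ge0.
  by rewrite mulr_ge0 // ltW.
have y1 : 0 < (y + 1) ^+ 2 by rewrite exprn_gt0 // ltr_wpDl.
have D0 : 0 < 8 * F * (V + 1) ^+ 2 by rewrite !mulr_gt0 ?exprn_gt0.
have q8 : 0 <= N / (8 * L ^+ 2) by rewrite divr_ge0 ?mulr_ge0 // ltW.
rewrite mulrA ler_pdivlMr //.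
apply: (@le_trans _ _ (rho ^+ 5 * expR (- 4) / (8 * F * (V + 1) ^+ 2) * L
                       * ((V + 1) ^+ 2 * L ^+ 2))).
  apply: ler_wpM2l E3; rewrite mulr_ge0 ?(ltW L0) // divr_ge0 ?(ltW D0) //.
  by rewrite mulr_ge0 ?expR_ge0 // exprn_ge0 // ltW.
apply: (@le_trans _ _ (N / (8 * L ^+ 2) * expR (- ((1 - rho) * L) - 4))); last first.
  exact: ler_wpM2l.
have -> : expR (- ((1 - rho) * L) - 4) = expR (rho * L) * expR (- 4) / N.
  by rewrite NE -expRN -!expRD; congr expR; ring.
have -> : N / (8 * L ^+ 2) * (expR (rho * L) * expR (- 4) / N)
   = expR (rho * L) * (expR (- 4) / (8 * L ^+ 2)).
  by field; rewrite !gt_eqF.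
have -> : rho ^+ 5 * expR (- 4) / (8 * F * (V + 1) ^+ 2) * L
          * ((V + 1) ^+ 2 * L ^+ 2)
   = rho ^+ 5 * L ^+ 5 / F * (expR (- 4) / (8 * L ^+ 2)).
  by field; rewrite !gt_eqF.
apply: ler_wpM2r E2.
by rewrite divr_ge0 ?expR_ge0 // mulr_ge0 // ltW.
Qed.

(** With L = ln n, each error term of the second moment and counting arguments
    is at most a constant over L, because n >= L ^ 3 / 6. *)
Lemma error_sum_le (d L N m mC c ab h : R) :
  0 < d -> 1 <= L -> 0 < N -> L ^+ 3 <= 6 * N -> N / L ^+ 2 / 2 <= m ->
  m <= N / L ^+ 2 -> N / 2 <= mC -> 0 < c -> 0 <= ab -> h = ab * L / N ->
  16 / m + 4 / mC / (d / 2) ^+ 2 + 8 * ((c * L)^-1 + 2 * (m * h))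
    + 8 / (c * L) ^+ 2
  <= (192 + 192 / d ^+ 2 + 8 / c + 16 * ab + 8 / c ^+ 2) / L.
Proof.
move=> d0 L1 N0 N3 m_ge m_le mC_ge c0 ab0 ->.
have L0 : 0 < L by apply: lt_le_trans L1.
have L2 : 0 < L ^+ 2 by rewrite exprn_gt0.
have iL2 : L ^+ 2 / N <= 6 / L.
  by rewrite ler_pdivrMr // mulrAC ler_pdivlMr // -exprSr.
have b1 : 16 / m <= 192 / L.
  have im : m^-1 <= 2 * (L ^+ 2 / N).
    rewrite -[leRHS]invrK lef_pV2 ?posrE ?invr_gt0 ?mulr_gt0 ?invr_gt0 //.
      apply: le_trans m_ge; rewrite le_eqVlt; apply/orP; left; apply/eqP.
      by field; rewrite !gt_eqF.
    by apply: lt_le_trans m_ge; rewrite !divr_gt0.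
  lra.
have b2 : 4 / mC / (d / 2) ^+ 2 <= 192 / d ^+ 2 / L.
  have mC0 : 0 < mC by apply: lt_le_trans mC_ge; rewrite divr_gt0.
  have i1 : mC^-1 <= 2 / N.
    rewrite -[leRHS]invrK lef_pV2 ?posrE ?invr_gt0 ?divr_gt0 //.
    by rewrite invfM invrK mulrC.
  have i2 : N^-1 <= L ^+ 2 / N.
    by rewrite ler_peMl ?invr_ge0 ?exprn_ege1 // ltW.
  have i3 : mC^-1 <= 12 / L by lra.
  rewrite (_ : 4 / _ / _ = mC^-1 * (16 / d ^+ 2)); last by field; rewrite !gt_eqF.
  rewrite (_ : 192 / _ / _ = 12 / L * (16 / d ^+ 2)); last by field; rewrite !gt_eqF.
  by apply: ler_wpM2r i3; rewrite divr_ge0 ?sqr_ge0.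
have b3 : m * (ab * L / N) <= ab / L.
  rewrite ler_pdivlMr // [leLHS](_ : _ = ab * ((m * L ^+ 2) / N)); last first.
    by field; rewrite gt_eqF.
  by rewrite ler_piMr // ler_pdivrMr // mul1r -ler_pdivlMr.
have b4 : 8 / (c * L) ^+ 2 <= 8 / c ^+ 2 / L.
  rewrite exprMn invfM mulrA; apply: ler_wpM2l.
    by rewrite divr_ge0 ?sqr_ge0.
  by rewrite lef_pV2 ?posrE // expr2 ler_peMr // ltW.
have b5 : 8 * ((c * L)^-1 + 2 * (m * (ab * L / N))) <= 8 / c / L + 16 * ab / L.
  rewrite mulrDr invfM; apply: lerD; first by rewrite mulrA.
  move: (m * _) b3 => z b3; rewrite -[16 * ab / L]mulrA.
  by move: (ab / L) b3; clear; move=> ?; lra.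
have distr (u v w x z l : R) :
  (u + v + w + x + z) * l = u * l + v * l + (w * l + x * l) + z * l by ring.
rewrite [leRHS]distr; exact: lerD (lerD (lerD b1 b2) b5) b4.
Qed.

Lemma scheme_prob_le (a b s : R) (X : exchange_scheme s) :
  0 < a -> 0 < b -> 0 <= s <= 1 -> scheme_exponent a b X < 1 ->
  exists C L0 : R, forall (n : nat) (est : graph n -> graph n -> labels n),
    L0 <= ln n%:R ->
    0 <= csbm_prob (a * ln n%:R / n%:R) (b * ln n%:R / n%:R) s
      (fun sigma G1 G2 => overlap (est G1 G2) sigma == 1 :> R) <= C / ln n%:R.
Proof.
move=> a0 b0 s01; rewrite /scheme_exponent.
have kS0 := hit_rate_ge0 X s01; have kT0 := clash_rate_ge0 X s01.
move: (hit_rate X) (clash_rate X) kS0 kT0 (fun n p q => @csbm_prob_recovery_le R n p q s X) => kS kT kS0 kT0 main.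
have [th thE] : exists th, th = Num.sqrt a * Num.sqrt b by eexists.
have th0 : 0 <= th by rewrite thE mulr_ge0 ?sqrtr_ge0.
have ab0 : 0 <= a + b by rewrite addr_ge0 // ltW.
have [U UE] : exists U, U = (kS + kT) * ((a + b) / 2) by eexists.
have [V VE] : exists V, V = kS * th by eexists.
have U0 : 0 <= U by rewrite UE mulr_ge0 ?divr_ge0 // addr_ge0.
have V0 : 0 <= V by rewrite VE mulr_ge0.
rewrite -thE -UE -VE => /(exponent_slack U0 V0)[d [rho [d0 d2 rho0 slack]]].
have [H HE] : exists H, H = (kS + kT) * (a + b) by eexists.
have H0 : 0 <= H by rewrite HE mulr_ge0 // addr_ge0.
have [F FE] : exists F : R, F = 5`!%:R by eexists.
have F0 : 0 < F by rewrite FE ltr0n fact_gt0.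
have [c cE] : exists c, c = rho ^+ 5 * expR (- 4) / (8 * F * (V + 1) ^+ 2) by eexists.
have V1 : 0 < V + 1 by apply: ltr_wpDl.
have c0 : 0 < c.
  rewrite cE; apply: divr_gt0; first by rewrite mulr_gt0 ?exprn_gt0 ?expR_gt0.
  by rewrite !mulr_gt0 ?exprn_gt0.
(* The threshold makes V0, the number of hits and the edge probabilities small
   compared with n, d n and 1 respectively. *)
exists (192 + 192 / d ^+ 2 + 8 / c + 16 * (a + b) + 8 / c ^+ 2),
  (12 + 12 * H / d + 4 / d + 24 * V / d + 7 * (a + b)).
move=> n est; have [L LE] : exists L : R, L = ln n%:R by eexists.
rewrite -LE => LL.
have [L12 LH Ld LV Lab] :
    [/\ 12 <= L, 12 * H <= d * L, 4 <= d * L, 24 * V <= d * L & 7 * (a + b) <= L].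
  have scale (x : R) : x / d <= L -> x <= d * L by rewrite ler_pdivrMr // mulrC.
  have T1 : 0 <= 12 * H / d by rewrite divr_ge0 ?mulr_ge0 // ltW.
  have T2 : 0 <= 4 / d by apply: divr_ge0; [rewrite ler0n|exact: ltW].
  have T3 : 0 <= 24 * V / d by rewrite divr_ge0 ?mulr_ge0 // ltW.
  clear main slack cE UE VE HE LE thE.
  by split; try apply: scale; lra.
have L1 : 1 <= L by apply: le_trans L12; rewrite ler1n.
have Lgt : 0 < L by apply: lt_le_trans L1.
have Lge := ltW Lgt.
have n0 : (0 < n)%N.
  by rewrite lt0n; apply: contraTneq Lgt => n0; rewrite LE n0 ln0 // ltxx.
have [N NN] : exists N : R, N = n%:R by eexists.
have N0 : 0 < N by rewrite NN ltr0n.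
have NE : N = expR L by rewrite NN LE lnK // posrE ltr0n.
have N3 : L ^+ 3 <= 6 * N.
  have := expR_ge1Dxn 2 Lge; rewrite -NE => E.
  have : L ^+ 3 / 6 <= N by apply: le_trans E; rewrite lerDr.
  by rewrite ler_pdivrMr // mulrC.
(* The size of V0: large enough to contain good vertices of both classes, and so
   small that a vertex has m h = O(1 / L) neighbours in V0 on average. *)
pose m := Num.trunc (N / L ^+ 2).
have L2gt : 0 < L ^+ 2 by rewrite exprn_gt0.
have /andP[m_le] := truncn_itv (divr_ge0 (ltW N0) (ltW L2gt)).
rewrite -natr1 => m_gt.
have [m_ge mN4] := window_size d0 L12 Ld N3 m_le m_gt.
have m0 : 0 < m%:R :> R by apply: lt_le_trans m_ge; rewrite !divr_gt0.
have mN2 : m%:R <= N / 2.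
  apply: (le_trans mN4); rewrite mulrC; apply: ler_wpM2l; first exact: ltW.
  by clear -d2; lra.
have mn : (m <= n)%N.
  rewrite -(ler_nat R) -NN; apply: (le_trans mN2).
  by rewrite ler_pdivrMr // ler_peMr ?ler1n // ltW.
have [B Bm] := exists_set_card mn.
have BC : #|~: B|%:R = N - m%:R :> R.
  have <- : (#|B| + #|~: B|)%:R = N by rewrite cardsC card_ord.
  by rewrite natrD Bm addrAC subrr add0r.
have BC2 : N / 2 <= #|~: B|%:R by rewrite BC; clear -mN2; lra.
have BC0 : (0 < #|~: B|)%N.
  by rewrite -(ltr0n R); apply: lt_le_trans BC2; rewrite divr_gt0.
have B0 : (0 < #|B|)%N by rewrite Bm -(ltr0n R).
have [y yE] : exists y, y = (1 - d) * V * L / 2 by eexists.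
have d1 : 0 <= 1 - d by clear -d2; lra.
have y0 : 0 <= y by rewrite yE divr_ge0 // !mulr_ge0.
have yE' : y = (1 - d) * (kS * (Num.sqrt a * Num.sqrt b)) * L / 2.
  by rewrite yE VE thE.
have VL0 : 0 <= V * L by rewrite mulr_ge0.
have yVL : 2 * y <= V * L.
  rewrite (_ : 2 * y = (1 - d) * (V * L)); last by rewrite yE; field.
  by rewrite ler_piMl // gerBl ltW.
have NV : V * L <= d / 4 * N.
  by have := linear_scale_le d0 L1 N3 LV; clear; lra.
have NH : (kS + kT) * (a + b) * L * (1 + d) <= d * n%:R.
  have HL := linear_scale_le d0 L1 N3 LH.
  rewrite -HE -NN; apply: (@le_trans _ _ (H * L * 2)).
    by apply: ler_wpM2l; [rewrite mulr_ge0|clear -d2; lra].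
  by clear -HL; lra.
have abN : (a + b) * L < N.
  have L1' : 7 * (a + b) <= 1 * L by rewrite mul1r.
  have := linear_scale_le ltr01 L1 N3 L1'; clear -N0; lra.
have [p pE] : exists p, p = a * L / N by eexists.
have [q qE] : exists q, q = b * L / N by eexists.
have [h hE] : exists h, h = (a + b) * L / N by eexists.
have p0 : 0 <= p by rewrite pE divr_ge0 ?mulr_ge0 ?ltW.
have q0 : 0 <= q by rewrite qE divr_ge0 ?mulr_ge0 ?ltW.
have pqh : p + q = h by rewrite hE pE qE -mulrDl -mulrDl.
have h1 : h < 1 by rewrite hE ltr_pdivrMr // mul1r.
have ph' : p <= h by rewrite -pqh lerDl.
have qh' : q <= h by rewrite -pqh lerDr.
have p01 : 0 <= p <= 1 by rewrite p0 (le_trans ph') ?ltW.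
have q01 : 0 <= q <= 1 by rewrite q0 (le_trans qh') ?ltW.
have r1 : 1 - (1 - s) ^+ 2 <= 1 by rewrite gerBl sqr_ge0.
have ph : p * (1 - (1 - s) ^+ 2) <= h.
  by apply: le_trans ph'; rewrite ler_piMr.
have qh : q * (1 - (1 - s) ^+ 2) <= h.
  by apply: le_trans qh'; rewrite ler_piMr.
have cL0 : 0 < c * L by rewrite mulr_gt0.
have t_le sigma : typical_labels B (d / 2) sigma -> forall l,
    c * L <= #|[set u in B | sigma u == l]|%:R
             * good_prob sigma B p q kS kT (Num.trunc y) l.
  move=> typ l.
  have By : #|B|%:R + 2 * y <= d / 2 * n%:R.
    by rewrite Bm -NN; clear -yVL NV mN4; lra.
  have G := good_prob_ge n0 (ltW a0) (ltW b0) kS0 kT0 Lge d0 d2 NH yE' erefl By typ l.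
  rewrite -UE -NN -pE -qE in G.
  have Bl : N / (8 * L ^+ 2) <= #|[set u in B | sigma u == l]|%:R.
    have /forallP/(_ l)/andP[+ _] := typ; rewrite Bm ltr_norml => /andP[+ _].
    have -> : N / (8 * L ^+ 2) = N / L ^+ 2 / 2 / 4 by field; rewrite gt_eqF.
    by move: m_ge; clear; lra.
  have q8 : 0 <= N / (8 * L ^+ 2) by rewrite divr_ge0 ?mulr_ge0 ?ltW.
  apply: le_trans (ler_pM q8 _ Bl G); last first.
    by rewrite divr_ge0 ?expR_ge0 ?sqr_ge0.
  rewrite cE; apply: (expected_good_ge FE) => //.
    rewrite mulrDl mul1r; apply: lerD => //.
    by move: yVL y0; clear; lra.
  have : ((1 + d) ^+ 2 * U - (1 - d) * V) * L <= (1 - rho) * L by apply: ler_wpM2r.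
  by rewrite yE; clear; lra.
rewrite -NN -pE -qE; apply/andP; split.
  rewrite csbm_prob_mass; apply: mass_ge0 => w; exact: config_pmf_ge0.
have := main n p q B est (Num.trunc y) h (c * L) (typical_labels B (d / 2))
  p01 q01 s01 h1 ph qh cL0 t_le.
move=> /le_trans; apply.
have d20 : 0 < d / 2 by rewrite divr_gt0.
apply: (le_trans (lerD (lerD (atypical_le d20 B0 BC0) (lexx _)) (lexx _))).
by rewrite Bm; apply: (error_sum_le d0 L1 N0 N3).
Qed.

Lemma scheme_impossible (a b s : R) (X : exchange_scheme s)
    (est : forall n : nat, graph n -> graph n -> labels n) :
  0 < a -> 0 < b -> 0 <= s <= 1 -> scheme_exponent a b X < 1 ->
  ((fun n : nat =>
     csbm_prob (a * ln n%:R / n%:R) (b * ln n%:R / n%:R) s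
       (fun (sigma : labels n) (G1 G2 : graph n) =>
          overlap (est n G1 G2) sigma == 1 :> R))
    @ \oo --> (0 : R))%classic.
Proof.
move=> a0 b0 s01 /(scheme_prob_le a0 b0 s01)[C [L0 HC]].
have bound (M : R) : (\forall n \near \oo, M <= ln (n%:R : R))%classic.
  exists (Num.trunc (expR M)).+1 => // n /= Mn.
  rewrite -[leLHS]expRK ler_ln ?posrE ?expR_gt0 //.
    rewrite (le_trans (ltW (truncnS_gt _))) // ler_nat //.
  by rewrite ltr0n (leq_trans _ Mn).
apply/cvgrPdist_le => e e0.
have := bound L0; have := bound (Num.max 1 (C / e)).
apply: filterS2 => n n1 n2.
have /andP[f0 fC] := HC n (est n) n2.
rewrite sub0r normrN ger0_norm //; apply: (le_trans fC).
move: n1; rewrite ge_max => /andP[l1 lC].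
have l0 : 0 < ln (n%:R : R) by apply: lt_le_trans l1.
by rewrite ler_pdivrMr // mulrC -ler_pdivrMr.
Qed.

End Asymptotics.

(** * The impossibility theorem *)

Lemma DplusE (R : realType) (a b : R) : 0 <= a -> 0 <= b ->
  Dplus a b = (a + b) / 2 - Num.sqrt a * Num.sqrt b.
Proof.
move=> a0 b0; rewrite /Dplus expr_div_n sqr_sqrtr // sqrrB !sqr_sqrtr //.
by field.
Qed.

Local Open Scope classical_set_scope.

Theorem theorem1p2 (R : realType) (alpha beta s : R)
    (halpha : 0 < alpha) (hbeta : 0 < beta) (hs : 0 <= s <= 1)
    (hyp : (1 - (1 - s) ^+ 2) * Dplus alpha beta < 1 \/
           s ^+ 2 * Tc alpha beta + s * (1 - s) * Dplus alpha beta < 1)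
    (est : forall n : nat, graph n -> graph n -> labels n) :
  (fun n : nat =>
     csbm_prob (alpha * ln n%:R / n%:R) (beta * ln n%:R / n%:R) s
       (fun (sigma : labels n) (G1 G2 : graph n) =>
          overlap (est n G1 G2) sigma == 1 :> R))
    @ \oo --> (0 : R).
Proof.
have expE (X : exchange_scheme s) : scheme_exponent alpha beta X
    = clash_rate X * Tc alpha beta + hit_rate X * Dplus alpha beta.
  by rewrite /scheme_exponent /Tc DplusE ?ltW //; ring.
case: hyp => [hU|hI].
  have [X [hitE clashE]] := union_scheme hs.
  by apply: (scheme_impossible (X := X)); rewrite // expE hitE clashE mul0r add0r.
have [X [hitE clashE]] := intersection_scheme hs.
by apply: (scheme_impossible (X := X)); rewrite // expE hitE clashE.
Qed.
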